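(* Let $\mathbb{G}$ be a locally compact quantum group and let $(N,\Delta_N)$ be a quantum homogeneous space of $\mathbb{G}$. Then the $\mathbb{G}$-$C^*$-algebra $\mathbb{D}$ is uniquely determined by conditions (1)–(3) in the definition of a quantum homogeneous space. That is, if $\mathbb{D}_1$ and $\mathbb{D}_2$ are $\mathbb{G}$-$C^*$-algebras which both satisfy conditions (1)–(3) for $(N,\Delta_N)$, then $C_0(\mathbb{D}_1)=C_0(\mathbb{D}_2)$ as subalgebras of $N$ (and hence $\mathbb{D}_1=\mathbb{D}_2$).
   Context: Conventions. $\mathbb{G}$ is a locally compact quantum group in the sense of Kustermans–Vaes: a von Neumann algebra $L^\infty(\mathbb{G})$ with a normal unital coassociative $*$-homomorphism $\Delta_{\mathbb{G}}:L^\infty(\mathbb{G})\to L^\infty(\mathbb{G})\bar\otimes L^\infty(\mathbb{G})$ admitting left and right invariant normal semifinite faithful weights. $L^2(\mathbb{G})$ is the GNS space of the left invariant weight, and $C_0(\mathbb{G})\subset L^\infty(\mathbb{G})\subset B(L^2(\mathbb{G}))$ is the associated (reduced) $C^*$-algebra. $\mathcal{K}(L^2(\mathbb{G}))$ denotes the compact operators, $\otimes$ is the minimal tensor product of $C^*$-algebras, $\mathrm{M}(A)$ is the multiplier algebra, $\mathrm{Mor}(A,B)$ is the set of nondegenerate $*$-homomorphisms $A\to \mathrm{M}(B)$, and $[\,\cdot\,]$ denotes closed linear span. For a $C^*$-algebra $D$, $\mathcal{L}(L^2(\mathbb{G})\otimes D)$ is the algebra of adjointable operators on the Hilbert $D$-module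 $L^2(\mathbb{G})\otimes D$, identified with $\mathrm{M}(\mathcal{K}(L^2(\mathbb{G}))\otimes D)$. Coaction on a von Neumann algebra. A (left) coaction of $\mathbb{G}$ on $N$ is an injective normal unital $*$-homomorphism $\Delta_N:N\to L^\infty(\mathbb{G})\bar\otimes N$ with $(\iota\otimes\Delta_N)\circ\Delta_N=(\Delta_{\mathbb{G}}\otimes\iota)\circ\Delta_N$. It is ergodic if $\{x\in N:\Delta_N(x)=1\otimes x\}=\mathbb{C}1$. $\mathbb{G}$-$C^*$-algebra. A pair $\mathbb{D}=(C_0(\mathbb{D}),\Delta_{\mathbb{D}})$ where $C_0(\mathbb{D})$ is a $C^*$-algebra and $\Delta_{\mathbb{D}}\in\mathrm{Mor}(C_0(\mathbb{D}),C_0(\mathbb{G})\otimes C_0(\mathbb{D}))$ is injective, satisfies $(\iota\otimes\Delta_{\mathbb{D}})\circ\Delta_{\mathbb{D}}=(\Delta_{\mathbb{G}}\otimes\iota)\circ\Delta_{\mathbb{D}}$, and is continuous: $[\Delta_{\mathbb{D}}(C_0(\mathbb{D}))(C_0(\mathbb{G})\otimes 1)]=C_0(\mathbb{G})\otimes C_0(\mathbb{D})$. Strictness. A unital $*$-homomorphism $\pi:N\to\mathcal{L}(\mathcal{E})$ ($\mathcal{E}$ a Hilbert $C^*$-module) is strict if it is $*$-strongly continuous on the unit ball of $N$: for every uniformly bounded $*$-strongly convergent net $x_i\in N$ and every $v\in\mathcal{E}$, the nets $\pi(x_i)v$ and $\pi(x_i^* )v$ converge in norm (to the values at the limit). Quantum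 homogeneous space (QHS). A von Neumann algebra $N$ with an ergodic coaction $\Delta_N:N\to L^\infty(\mathbb{G})\bar\otimes N$ is a quantum homogeneous space of $\mathbb{G}$ if there exists a $\mathbb{G}$-$C^*$-algebra $\mathbb{D}$ such that: (1) $C_0(\mathbb{D})$ is a strongly dense $C^*$-subalgebra of $N$; (2) $\Delta_{\mathbb{D}}$ is the restriction of $\Delta_N$ to $C_0(\mathbb{D})$; (3) $\Delta_N(N)\subset \mathrm{M}(\mathcal{K}(L^2(\mathbb{G}))\otimes C_0(\mathbb{D}))$ and the map $\Delta_N:N\to\mathcal{L}(L^2(\mathbb{G})\otimes C_0(\mathbb{D}))$ is strict. *)

(* Defs.v *)
From HB Require Import structures.
From mathcomp Require Import all_boot all_order all_algebra sesquilinear.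
From mathcomp Require Import complex.
From mathcomp Require Import all_classical all_reals all_analysis.

Set Implicit Arguments.
Unset Strict Implicit.
Unset Printing Implicit Defensive.

Import Order.TTheory GRing.Theory Num.Theory.
Import numFieldNormedType.Exports.

Local Open Scope classical_set_scope.
Local Open Scope complex_scope.
Local Open Scope ring_scope.

(* A C*-algebra, a von Neumann algebra, a multiplier algebra or a Hilbert      *)
(* module is given here as a set of bounded operators between Hilbert spaces;  *)
(* operators are functions satisfying [bop], so that [\o], [+] and [*:] are    *)
(* those of functions.                                                         *)

Section HilbertSpaces.
Variable R : realType.

(* [hdot] is linear in its first argument and antilinear in the second one. *)
Record hilbert := Hilbert {
  hsort :> completeNormedModType R[i] ;
  hdot : {dot hsort for Num.conj} ;
  hdot_norm : forall x, hdot x x = `|x| ^+ 2 }.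

End HilbertSpaces.

Notation "⟨ x , y ⟩" := (hdot _ x y) (format "⟨ x ,  y ⟩") : ring_scope.

Definition lspan (K : pzRingType) (V : lmodType K) (A : set V) : set V :=
  [set x | exists (n : nat) (c : 'I_n -> K) (a : 'I_n -> V),
     (forall i, A (a i)) /\ x = \sum_(i < n) c i *: a i].

Section Operators.
Variable R : realType.
Implicit Types H K L : hilbert R.

Definition bop H K (f : H -> K) : Prop := linear f /\ continuous f.

(* the operator norm of f is at most c *)
Definition opnorm_le H K (f : H -> K) (c : R[i]) : Prop :=
  forall x, `|f x| <= c * `|x|.

Definition opclosure H K (A : set (H -> K)) : set (H -> K) :=
  [set x | bop x /\
     forall e : R[i], 0 < e -> exists2 a, A a & opnorm_le (x - a) e].

(* [ A ], the closed linear span for the operator norm *)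
Definition cspan H K (A : set (H -> K)) : set (H -> K) := opclosure (lspan A).

(* By the Riesz representation theorem the set below is a singleton when f is
   bounded. *)
Definition adj H K (f : H -> K) : K -> H :=
  xget (fun=> 0) [set g | bop g /\ forall x y, ⟨f x, y⟩ = ⟨x, g y⟩].

Definition leop H (x y : H -> H) : Prop := forall xi, ⟨x xi, xi⟩ <= ⟨y xi, xi⟩.

(* The cone of positive operators of M; [0 <= z] in R[i] entails that z is
   real, hence these operators are self-adjoint. *)
Definition pos H (M : set (H -> H)) : set (H -> H) :=
  [set x | M x /\ forall xi, 0 <= ⟨x xi, xi⟩].

Definition directed H (S : set (H -> H)) : Prop :=
  S !=set0 /\ forall x y, S x -> S y -> exists z, [/\ S z, leop x z & leop y z].

Definition is_sup H (M S : set (H -> H)) (s : H -> H) : Prop :=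
  [/\ M s, forall x, S x -> leop x s &
      forall t, M t -> (forall x, S x -> leop x t) -> leop s t].

Definition strongly_dense H (D N : set (H -> H)) : Prop :=
  forall x (e : R[i]) (xis : seq H), N x -> 0 < e ->
    exists2 d, D d & forall xi, xi \in xis -> `|x xi - d xi| < e.

Definition nondegenerate H (D : set (H -> H)) : Prop :=
  dense (lspan [set v : H | exists d xi, D d /\ v = d xi]).

Definition compact_op H : set (H -> H) :=
  [set x | bop x /\ compact (closure (x @` [set xi | `|xi| <= 1]))].

Definition commutant H (M : set (H -> H)) : set (H -> H) :=
  [set x | bop x /\ forall y, M y -> x \o y = y \o x].

Record von_neumann H (M : set (H -> H)) : Prop := VonNeumann {
  vn_bop : forall x, M x -> bop x ;
  vn_adj : forall x, M x -> M (adj x) ;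
  vn_bicommutant : commutant (commutant M) = M }.

Record cstar_algebra H (D : set (H -> H)) : Prop := CstarAlgebra {
  cs_bop : forall x, D x -> bop x ;
  cs_0 : D (fun=> 0) ;
  cs_lin : forall (a : R[i]) x y, D x -> D y -> D (a *: x + y) ;
  cs_mul : forall x y, D x -> D y -> D (x \o y) ;
  cs_adj : forall x, D x -> D (adj x) ;
  cs_closed : opclosure D `<=` D }.

(* M(A) for a C*-algebra A acting nondegenerately on H *)
Definition multipliers H (A : set (H -> H)) : set (H -> H) :=
  [set x | bop x /\ forall a, A a -> A (x \o a) /\ A (a \o x)].

Record star_hom H K (A : set (H -> H)) (B : set (K -> K))
    (pi : (H -> H) -> (K -> K)) : Prop := StarHom {
  sh_map : forall x, A x -> B (pi x) ;
  sh_lin : forall (a : R[i]) x y, A x -> A y ->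
    pi (a *: x + y) = a *: pi x + pi y ;
  sh_mul : forall x y, A x -> A y -> pi (x \o y) = pi x \o pi y ;
  sh_adj : forall x, A x -> pi (adj x) = adj (pi x) }.

Definition normal_hom H K (M : set (H -> H)) (P : set (K -> K))
    (pi : (H -> H) -> (K -> K)) : Prop :=
  forall S s, S `<=` pos M -> directed S -> is_sup M S s ->
    is_sup P (pi @` S) (pi s).

End Operators.

(* A Hilbert space tensor product of H and K, which these properties determine
   up to a unique unitary compatible with [tens]. *)
Record htensor (R : realType) (H K : hilbert R) := HTensor {
  tsort :> hilbert R ;
  tens : {bilinear H -> K -> tsort} ;
  tens_dot : forall x x' y y',
    ⟨tens x y, tens x' y'⟩ = ⟨x, x'⟩ * ⟨y, y'⟩ ;
  tens_total : dense (lspan [set v : tsort | exists x y, v = tens x y]) }.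

Section TensorProducts.
Variables (R : realType) (H K : hilbert R) (T : htensor H K).

(* a ⊗ b *)
Definition tensop (a : H -> H) (b : K -> K) : T -> T :=
  xget (fun=> 0) [set x | bop x /\
    forall xi eta, x (tens T xi eta) = tens T (a xi) (b eta)].

(* von Neumann algebra tensor product *)
Definition vtens (M : set (H -> H)) (N : set (K -> K)) : set (T -> T) :=
  commutant (commutant
    [set x | exists a b, [/\ M a, N b & x = tensop a b]]).

(* minimal C*-tensor product *)
Definition ctens (A : set (H -> H)) (B : set (K -> K)) : set (T -> T) :=
  cspan [set x | exists a b, [/\ A a, B b & x = tensop a b]].

(* With ω_{ξ,ξ'}(x) = ⟨xξ, ξ'⟩, [slice_l xi xi' X] is (ω_{ξ,ξ'} ⊗ ι)(X) and
   [slice_r eta eta' X] is (ι ⊗ ω_{η,η'})(X). *)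
Definition slice_l (xi xi' : H) (X : T -> T) : K -> K :=
  adj (tens T xi') \o X \o tens T xi.

Definition slice_r (eta eta' : K) (X : T -> T) : H -> H :=
  adj (fun xi => tens T xi eta') \o X \o (fun xi => tens T xi eta).

(* The positive normal functionals are the ω = Σ_n ω_{ξ_n,ξ_n} with
   ω(1) = Σ_n ‖ξ_n‖² finite. *)
Definition functional_mass (V : hilbert R) (xi : nat -> V) (w : R) : Prop :=
  series (fun n => ⟨xi n, xi n⟩ : R[i]^o) @ \oo --> (w%:C : R[i]^o).

(* y = (ω ⊗ ι)(X), resp. y = (ι ⊗ ω)(X), for ω = Σ_n ω_{ξ_n,ξ_n} *)
Definition is_slice_l (xi : nat -> H) (X : T -> T) (y : K -> K) : Prop :=
  forall eta eta', series (fun n => ⟨slice_l (xi n) (xi n) X eta, eta'⟩ : R[i]^o)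
    @ \oo --> (⟨y eta, eta'⟩ : R[i]^o).

Definition is_slice_r (xi : nat -> K) (X : T -> T) (y : H -> H) : Prop :=
  forall eta eta', series (fun n => ⟨slice_r (xi n) (xi n) X eta, eta'⟩ : R[i]^o)
    @ \oo --> (⟨y eta, eta'⟩ : R[i]^o).

End TensorProducts.

Arguments tensop {R H K} T a b.
Arguments vtens {R H K} T M N.
Arguments ctens {R H K} T A B.

Section Coassociativity.
Variables (R : realType) (H K : hilbert R).
Variables (HH : htensor H H) (HK : htensor H K) (HHK : htensor H HK).

(* Y = (ι ⊗ δ)(X), which is determined by
   (ω ⊗ ι ⊗ ι)(Y) = δ((ω ⊗ ι)(X)) for all ω *)
Definition is_id_tens (delta : (K -> K) -> (HK -> HK))
    (X : HK -> HK) (Y : HHK -> HHK) : Prop :=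
  bop Y /\ forall xi xi', slice_l xi xi' Y = delta (slice_l xi xi' X).

(* Y = (Δ ⊗ ι)(X), which is determined by
   (ι ⊗ ι ⊗ ω)(Y) = Δ((ι ⊗ ω)(X)) for all ω, with (H ⊗ H) ⊗ K identified with
   H ⊗ (H ⊗ K) *)
Definition is_tens_id (Delta : (H -> H) -> (HH -> HH))
    (X : HK -> HK) (Y : HHK -> HHK) : Prop :=
  bop Y /\ forall (eta eta' : K) (x1 x2 y1 y2 : H),
    ⟨Y (tens HHK x1 (tens HK x2 eta)), tens HHK y1 (tens HK y2 eta')⟩ =
    ⟨Delta (slice_r eta eta' X) (tens HH x1 x2), tens HH y1 y2⟩.

(* (ι ⊗ δ') ∘ δ = (Δ ⊗ ι) ∘ δ on N; here δ' is δ or an extension of it. *)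
Definition coassociative (Delta : (H -> H) -> (HH -> HH))
    (delta' delta : (K -> K) -> (HK -> HK)) (N : set (K -> K)) : Prop :=
  forall x, N x -> exists Y : HHK -> HHK,
    is_id_tens delta' (delta x) Y /\ is_tens_id Delta (delta x) Y.

End Coassociativity.

Section Weights.
Variables (R : realType) (H : hilbert R) (M : set (H -> H)).
Variable phi : (H -> H) -> \bar R.

(* N_φ = {x ∈ M : φ(x* x) < ∞} *)
Definition left_ideal : set (H -> H) :=
  [set x | M x /\ (phi (adj x \o x) < +oo)%E].

Record nsf_weight : Prop := NsfWeight {
  wt_ge0 : forall x, pos M x -> (0 <= phi x)%E ;
  wt_add : forall x y, pos M x -> pos M y -> phi (x + y) = (phi x + phi y)%E ;
  wt_scale : forall (r : R) x, 0 <= r -> pos M x ->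
    phi (r%:C *: x) = (r%:E * phi x)%E ;
  wt_normal : forall S s, S `<=` pos M -> directed S -> is_sup M S s ->
    phi s = ereal_sup (phi @` S) ;
  wt_semifinite : strongly_dense left_ideal M ;
  wt_faithful : forall x, pos M x -> phi x = 0%E -> x = (fun=> 0) }.

(* (H, Λ) is a GNS construction for φ in which M acts by its inclusion in B(H);
   ⟨Λ x, Λ y⟩ = φ(y* x) follows by polarization. *)
Record gns (Lambda : (H -> H) -> H) : Prop := Gns {
  gns_lin : forall (a : R[i]) x y, left_ideal x -> left_ideal y ->
    Lambda (a *: x + y) = a *: Lambda x + Lambda y ;
  gns_dot : forall x, left_ideal x ->
    ⟨Lambda x, Lambda x⟩ = (fine (phi (adj x \o x)))%:C ;
  gns_act : forall a x, M a -> left_ideal x -> Lambda (a \o x) = a (Lambda x) ;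
  gns_dense : dense (Lambda @` left_ideal) }.

Variables (HH : htensor H H) (Delta : (H -> H) -> (HH -> HH)).

(* φ((ω ⊗ ι)Δ(x)) = ω(1) φ(x) for ω in the positive cone of the predual and x
   positive with φ(x) < ∞, and the right-handed analogue *)
Definition left_invariant : Prop :=
  forall (xi : nat -> H) (w : R) x y, functional_mass xi w ->
    pos M x -> (phi x < +oo)%E -> M y -> is_slice_l xi (Delta x) y ->
    phi y = (w%:E * phi x)%E.

Definition right_invariant : Prop :=
  forall (xi : nat -> H) (w : R) x y, functional_mass xi w ->
    pos M x -> (phi x < +oo)%E -> M y -> is_slice_r xi (Delta x) y ->
    phi y = (w%:E * phi x)%E.

End Weights.

(* A locally compact quantum group, L^oo(G) being realized on the GNS space
   L^2(G) of the left invariant weight. *)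
Record lcqg (R : realType) := LCQG {
  L2 : hilbert R ;
  L2L2 : htensor L2 L2 ;
  L2L2L2 : htensor L2 L2L2 ;
  Linf : set (L2 -> L2) ;
  Linf_vn : von_neumann Linf ;
  Delta : (L2 -> L2) -> (L2L2 -> L2L2) ;
  Delta_hom : star_hom Linf (vtens L2L2 Linf Linf) Delta ;
  Delta_unital : Delta idfun = idfun ;
  Delta_normal : normal_hom Linf (vtens L2L2 Linf Linf) Delta ;
  Delta_coassoc : coassociative L2L2L2 Delta Delta Delta Linf ;
  haar : (L2 -> L2) -> \bar R ;
  haar_nsf : nsf_weight Linf haar ;
  haar_left : left_invariant Linf haar Delta ;
  Lambda : (L2 -> L2) -> L2 ;
  Lambda_gns : gns Linf haar Lambda ;
  right_haar : exists2 psi : (L2 -> L2) -> \bar R,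
    nsf_weight Linf psi & right_invariant Linf psi Delta }.

Arguments Linf {R} l.
Arguments Delta {R} l.
Arguments haar {R} l.
Arguments Lambda {R} l.

Section QuantumGroup.
Variables (R : realType) (G : lcqg R).

(* The left regular representation W of G, the bounded operator with adjoint W†
   such that W†(Λ(a) ⊗ Λ(b)) = (Λ ⊗ Λ)(Δ(b)(a ⊗ 1)) for a, b ∈ N_φ, or equivalently
   (ω ⊗ ι)(W†) Λ(b) = Λ((ω ⊗ ι)Δ(b)) for all ω and all b ∈ N_φ; the latter
   formula is used because it does not involve the weight φ ⊗ φ. *)
Definition regular_rep : L2L2 G -> L2L2 G :=
  xget (fun=> 0) [set W | bop W /\ forall xi xi' b,
    left_ideal (Linf G) (haar G) b ->
    slice_l xi xi' (adj W) (Lambda G b) = Lambda G (slice_l xi xi' (Delta G b))].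

(* C_0(G) = [(ι ⊗ ω)(W) : ω ∈ B(L^2(G))_*]; finite linear combinations of the
   ω_{ξ,ξ'} are norm dense in the predual. *)
Definition C0 : set (L2 G -> L2 G) :=
  cspan [set x | exists xi xi', x = slice_r xi xi' regular_rep].

Variables (K : hilbert R) (GK : htensor (L2 G) K).
Variable GGK : htensor (L2 G) GK.

Record coaction (N : set (K -> K)) (DN : (K -> K) -> (GK -> GK)) : Prop :=
    Coaction {
  co_hom : star_hom N (vtens GK (Linf G) N) DN ;
  co_unital : DN idfun = idfun ;
  co_normal : normal_hom N (vtens GK (Linf G) N) DN ;
  co_inj : {in N &, injective DN} ;
  co_coassoc : coassociative GGK (Delta G) DN DN N }.

Definition ergodic (N : set (K -> K)) (DN : (K -> K) -> (GK -> GK)) : Prop :=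
  [set x | N x /\ DN x = tensop GK idfun x] =
  [set x | exists c : R[i], x = c *: idfun].

(* The extension M(D) -> M(B) of a nondegenerate *-homomorphism D -> M(B). *)
Definition ext_hom (D : set (K -> K)) (dD : (K -> K) -> (GK -> GK))
    (m : K -> K) : GK -> GK :=
  xget (fun=> 0) [set y | bop y /\ forall d, D d -> y \o dD d = dD (m \o d)].

(* A G-C*-algebra whose C*-algebra acts faithfully and nondegenerately on K, so
   that M(C_0(G) ⊗ C_0(D)) is an algebra of operators on L^2(G) ⊗ K. *)
Record gcstar := GCstar {
  C0D : set (K -> K) ;
  DeltaD : (K -> K) -> (GK -> GK) ;
  gc_cstar : cstar_algebra C0D ;
  gc_nondeg : nondegenerate C0D ;
  gc_hom : star_hom C0D (multipliers (ctens GK C0 C0D)) DeltaD ;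
  gc_mor : cspan [set x | exists d z,
      [/\ C0D d, ctens GK C0 C0D z & x = DeltaD d \o z]] = ctens GK C0 C0D ;
  gc_inj : {in C0D &, injective DeltaD} ;
  gc_coassoc : coassociative GGK (Delta G) (ext_hom C0D DeltaD) DeltaD C0D ;
  gc_continuous : cspan [set x | exists d c,
      [/\ C0D d, C0 c & x = DeltaD d \o tensop GK c idfun]] =
      ctens GK C0 C0D }.

(* The Hilbert D-module L^2(G) ⊗ D, realized in B(K, L^2(G) ⊗ K) as the closed
   span of the operators η ↦ ξ ⊗ dη; its D-valued inner product is (v, w) ↦ v*w
   and M(K(L^2(G)) ⊗ D) acts on it by composition. *)
Definition hmodule (D : set (K -> K)) : set (K -> GK) :=
  cspan [set v | exists xi d, D d /\ v = tens GK xi \o d].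

(* Nets are replaced by families indexed by a filtered set. *)
Definition strict_hom (N D : set (K -> K)) (pi : (K -> K) -> (GK -> GK))
    : Prop :=
  forall (I : Type) (F : set_system I) (x : I -> (K -> K)) (x0 : K -> K)
    (c : R[i]), ProperFilter F ->
  (forall i, N (x i)) -> N x0 -> (forall i, opnorm_le (x i) c) ->
  (forall xi, x i xi @[i --> F] --> x0 xi) ->
  (forall xi, adj (x i) xi @[i --> F] --> adj x0 xi) ->
  forall v, hmodule D v -> forall e : R[i], 0 < e ->
    (\forall i \near F, opnorm_le ((pi (x i) \o v) - (pi x0 \o v)) e) /\
    (\forall i \near F,
       opnorm_le ((pi (adj (x i)) \o v) - (pi (adj x0) \o v)) e).

(* The conditions (1)-(3) on a G-C*-algebra in the definition of a QHS *)
Record qhs_conditions (N : set (K -> K)) (DN : (K -> K) -> (GK -> GK))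
    (D : gcstar) : Prop := QHSConditions {
  qc_sub : C0D D `<=` N ;
  qc_dense : strongly_dense (C0D D) N ;
  qc_restr : forall x, C0D D x -> DeltaD D x = DN x ;
  qc_mult : forall x, N x ->
    multipliers (ctens GK (@compact_op _ (L2 G)) (C0D D)) (DN x) ;
  qc_strict : strict_hom N (C0D D) DN }.

Record qhs (N : set (K -> K)) (DN : (K -> K) -> (GK -> GK)) : Prop := QHS {
  qhs_vn : von_neumann N ;
  qhs_coaction : coaction N DN ;
  qhs_ergodic : ergodic N DN ;
  qhs_ex : exists D, qhs_conditions N DN D }.

End QuantumGroup.

(* Main.v *)
Require Import Defs.
From HB Require Import structures.
From mathcomp Require Import all_boot all_order all_algebra sesquilinear.
From mathcomp Require Import complex ring lra.
From mathcomp Require Import all_classical all_reals all_analysis.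

(* Write t_ξ for the operator η ↦ ξ ⊗ η. Continuity of D1 makes c ⊗ d1, for c in
   C_0(G), a limit of combinations of Δ(d)(c' ⊗ 1), and Δ(N) multiplies the
   module L^2(G) ⊗ D2; hence, after compressing by t_η^* and t_ξ with
   ⟨cξ, η⟩ = 1, D1 D2 ⊂ D2, and symmetrically. An approximate unit (u_i) of D2
   tends *-strongly to 1, so by strictness Δ(u_i) (cξ ⊗ d1) → cξ ⊗ d1 in norm;
   applying t_η^*, the elements y_i d1 tend to d1, where
   y_i = t_η^* Δ(u_i)(c ⊗ 1) t_ξ lies in D2 by continuity of D2. As D2 D1 ⊂ D2,
   this gives D1 ⊂ D2.
   The argument needs C_0(G) ≠ 0, that is, the existence of the regular
   representation: left invariance makes ξ ⊗ Λ(b) ↦ Δ(b) t_ξ isometric for the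
   quadratic form T ↦ φ(T^*T), and Λ applied to the slices of the image is
   Hilbert-Schmidt, which defines the adjoint of W. *)

Set Implicit Arguments.
Unset Strict Implicit.
Unset Printing Implicit Defensive.

Import Order.TTheory GRing.Theory Num.Theory.
Import numFieldNormedType.Exports.

Local Open Scope classical_set_scope.
Local Open Scope complex_scope.
Local Open Scope ring_scope.

(** * Hilbert spaces *)

(** [regular_rep] is chosen with default value 0, so until an operator with its defining property is
    exhibited, [C0] could be 0 and the continuity of a G-C*-algebra would say nothing about it. What
    is finally extracted is one [c] in [C0] with ⟨cξ, η⟩ = 1; then t_η^* (c ⊗ d) t_ξ = d, which is
    how elements of D are read off from tensors. The obstacle on the way is that the axioms control
    φ on positive elements only. No sesquilinear form φ(S^* T) is at hand, so left invariance cannot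
    be extended from the single operators Δ(b) t_ξ to their sums by expanding an inner product. The
    substitute is that T ↦ φ(T^* T) obeys the parallelogram law and is invariant under
    multiplication by i, which suffices for forms built from elementary tensors. The product weight
    φ ⊗ φ is replaced by Bessel's inequality for the slices of T. *)

Section InnerProduct.
Variables (R : realType) (H : hilbert R).
Implicit Types (x y z : H) (a : R[i]).

Lemma dotDl x y z : ⟨x + y, z⟩ = ⟨x, z⟩ + ⟨y, z⟩.
Proof. by rewrite linearDl. Qed.
Lemma dotDr x y z : ⟨x, y + z⟩ = ⟨x, y⟩ + ⟨x, z⟩.
Proof. by rewrite linearDr. Qed.
Lemma dotZl a x z : ⟨a *: x, z⟩ = a * ⟨x, z⟩.
Proof. by rewrite linearZl_LR. Qed.
Lemma dotZr a x z : ⟨x, a *: z⟩ = a^*%C * ⟨x, z⟩.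
Proof. by rewrite linearZr_LR. Qed.
Lemma dotNl x z : ⟨- x, z⟩ = - ⟨x, z⟩.
Proof. by rewrite linearNl. Qed.
Lemma dotNr x z : ⟨x, - z⟩ = - ⟨x, z⟩.
Proof. by rewrite linearNr. Qed.
Lemma dotBl x y z : ⟨x - y, z⟩ = ⟨x, z⟩ - ⟨y, z⟩.
Proof. by rewrite linearBl. Qed.
Lemma dotBr x y z : ⟨x, y - z⟩ = ⟨x, y⟩ - ⟨x, z⟩.
Proof. by rewrite linearBr. Qed.
Lemma dot0l z : ⟨0, z⟩ = 0 :> R[i].
Proof. by rewrite linear0l. Qed.
Lemma dot0r z : ⟨z, 0⟩ = 0 :> R[i].
Proof. by rewrite linear0r. Qed.
Lemma dotC x y : ⟨x, y⟩ = ⟨y, x⟩^*%C.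
Proof. by rewrite (hermC (hdot H)) expr0 mul1r. Qed.

(** Norms take values in [R[i]]; real inequalities are stated for the real part, which carries the
    whole norm. *)
Definition rnorm x : R := complex.Re `|x|.

Lemma normE x : `|x| = (rnorm x)%:C.
Proof. by rewrite RRe_real. Qed.

Lemma rnorm_ge0 x : 0 <= rnorm x.
Proof. by rewrite -lecR -normE; exact: normr_ge0. Qed.

Lemma dotxx x : ⟨x, x⟩ = (rnorm x ^+ 2)%:C.
Proof. by rewrite hdot_norm normE rmorphXn. Qed.

Lemma Re_dotC x y : complex.Re ⟨x, y⟩ = complex.Re ⟨y, x⟩.
Proof. by rewrite dotC; case: (⟨y, x⟩). Qed.

Lemma Re_dotD x y : rnorm (x + y) ^+ 2 =
  rnorm x ^+ 2 + rnorm y ^+ 2 + 2 * complex.Re ⟨x, y⟩.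
Proof.
have := dotxx (x + y); rewrite dotDl !dotDr !dotxx => /(congr1 (@complex.Re R)).
by rewrite !raddfD /= (Re_dotC y) => <-; ring.
Qed.

Lemma Re_dotB x y : rnorm (x - y) ^+ 2 =
  rnorm x ^+ 2 + rnorm y ^+ 2 - 2 * complex.Re ⟨x, y⟩.
Proof.
rewrite Re_dotD dotNr raddfN /= mulrN; congr (_ + _ ^+2 - _).
by rewrite /rnorm normrN.
Qed.

Lemma rnorm0 : rnorm 0 = 0. Proof. by rewrite /rnorm normr0. Qed.

Lemma rnorm_eq0 x : rnorm x = 0 -> x = 0.
Proof. by move=> h; apply/eqP; rewrite -normr_eq0 normE h. Qed.

Lemma rnormZ a x : rnorm (a *: x) = complex.Re `|a| * rnorm x.
Proof.
apply: complexI; rewrite -normE normrZ normE rmorphM /=.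
by rewrite (RRe_real (ger0_real (normr_ge0 a))).
Qed.

Lemma rnormN x : rnorm (- x) = rnorm x.
Proof. by rewrite /rnorm normrN. Qed.

Lemma dot_le x y : `|⟨x, y⟩| <= `|x| * `|y|.
Proof.
have [->|y0] := eqVneq y 0; first by rewrite dot0r !normr0 mulr0.
rewrite -(ler_pXn2r (n := 2)) ?nnegrE ?mulr_ge0 // exprMn.
have y2 : 0 < `|y| ^+ 2 by rewrite exprn_gt0 // normr_gt0.
rewrite -ler_pdivrMr //.
have : 0 <= `|x - (⟨x, y⟩ / `|y| ^+ 2) *: y| ^+ 2 by rewrite exprn_ge0.
rewrite -hdot_norm dotBl !dotBr !dotZl !dotZr !hdot_norm (dotC y x).
have cy : (`|y| ^+ 2)^*%C = `|y| ^+ 2 :> R[i] by rewrite -hdot_norm -dotC.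
rewrite (rmorphM conjc) (fmorphV conjc) /= cy.
set d := ⟨x, y⟩ => h; rewrite sqr_normc -subr_ge0.
suff -> : `|x| ^+ 2 - d * d^* / `|y| ^+ 2 = `|x| ^+ 2 - d^* / `|y| ^+ 2 * d -
  (d / `|y| ^+ 2 * d^* - d / `|y| ^+ 2 * (d^* / `|y| ^+ 2 * `|y| ^+ 2)) by [].
by field; rewrite normr_eq0 y0.
Qed.

Lemma Re_dot_le x y : complex.Re ⟨x, y⟩ <= rnorm x * rnorm y.
Proof.
have := dot_le x y; rewrite !normE -rmorphM /= => h.
rewrite (le_trans (ler_norm _)) // -lecR.
exact: le_trans (normc_ge_Re _) h.
Qed.

Lemma dot_inj x y : (forall z, ⟨x, z⟩ = ⟨y, z⟩) -> x = y.
Proof.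
move=> h; apply/eqP; rewrite -subr_eq0; apply/eqP; apply: rnorm_eq0.
apply/eqP; rewrite -sqrf_eq0; apply/eqP.
by apply: complexI; rewrite -dotxx dotBl h subrr.
Qed.

Lemma dot_injr x y : (forall z, ⟨z, x⟩ = ⟨z, y⟩) -> x = y.
Proof. by move=> h; apply: dot_inj => z; rewrite dotC h -dotC. Qed.

Lemma dot_suml I (r : seq I) (P : pred I) (F : I -> H) y :
  ⟨\sum_(i <- r | P i) F i, y⟩ = \sum_(i <- r | P i) ⟨F i, y⟩.
Proof. by rewrite linear_sumlz. Qed.

Lemma dense_ex (A : set H) x (e : R[i]) : dense A -> 0 < e ->
  exists2 y, A y & `|x - y| < e.
Proof.
move=> dA e0; have : (ball x e)^° `&` A !=set0.
  apply: dA; last exact: open_interior.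
  by exists x; apply: nbhsx_ballx.
by case=> y [/interior_subset]; rewrite -ball_normE /= => h Ay; exists y.
Qed.

Lemma lspanP (V : lmodType R[i]) (A B : set V) : B 0 ->
  (forall (c : R[i]) u v, A u -> B v -> B (c *: u + v)) -> lspan A `<=` B.
Proof.
move=> B0 Bl _ [n [c [a [Aa ->]]]]; elim: n c a Aa => [|n IH] c a Aa.
  by rewrite big_ord0.
by rewrite big_ord_recl; apply: Bl => //; apply: IH => i.
Qed.

Lemma dense_ortho0 (A : set H) y : dense (lspan A) ->
  (forall x, A x -> ⟨x, y⟩ = 0) -> y = 0.
Proof.
move=> dA h; apply/eqP; rewrite -normr_eq0; apply/eqP.
have ortho x : lspan A x -> ⟨x, y⟩ = 0.
  apply: (@lspanP _ A [set x : H | ⟨x, y⟩ = 0]) => /=; first by rewrite dot0l.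
  by move=> c u v Au /= v0; rewrite dotDl dotZl v0 h// mulr0 addr0.
apply/eqP; rewrite eq_le normr_ge0 andbT; apply/ler_addgt0Pl => e e0; rewrite addr0.
have [x Ax] := dense_ex y dA e0.
have [-> _|y0] := eqVneq y 0; first by rewrite normr0 ltW.
move=> /ltW; apply: le_trans.
have y0' : 0 < `|y| by rewrite normr_gt0.
rewrite -(ler_pM2r y0') -expr2 -hdot_norm.
rewrite -[X in X <= _]ger0_norm; last by rewrite hdot_norm exprn_ge0.
by apply: le_trans (dot_le _ _); rewrite dotBl (ortho x) // subr0.
Qed.

End InnerProduct.

(** * The Riesz representation theorem for a functional given by its graph *)

Section Riesz.
Variables (R : realType) (H : hilbert R) (rho : H -> R[i] -> Prop) (C : R).
Hypothesis rho0 : rho 0 0.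
Hypothesis rhol : forall a v r v' r',
  rho v r -> rho v' r' -> rho (a *: v + v') (a * r + r').
Hypothesis rhoC : forall v r, rho v r -> `|r| <= C%:C * `|v|.

(** If r = ⟨v, w⟩, this is |v - w|^2 - |w|^2: near-minimizers over the graph converge to the
    representing vector. *)
Let J (v : H) (r : R[i]) : R := rnorm v ^+ 2 - 2 * complex.Re r.
Let E : set R := [set j | exists v r, rho v r /\ j = J v r].

Let J_lb v r : rho v r -> - C ^+ 2 <= J v r.
Proof.
move=> /rhoC; rewrite normE -rmorphM /= => h; rewrite /J.
have : complex.Re r <= C * rnorm v.
  rewrite (le_trans (ler_norm _)) // -lecR.
  exact: le_trans (normc_ge_Re _) h.
by have := sqr_ge0 (rnorm v - C); nra.
Qed.

Let E_inf : has_inf E.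
Proof.
split; first by exists (J 0 0), 0, 0.
by exists (- C ^+ 2) => _ [v [r [/J_lb h ->]]].
Qed.

Let m := inf E.

Let m_le v r : rho v r -> m <= J v r.
Proof. by move=> h; apply: ge_inf; [case: E_inf | exists v, r]. Qed.

Let A (e : R) : set H := [set v | exists2 r, rho v r & J v r <= m + e].

Let A_ne e : 0 < e -> A e !=set0.
Proof.
move=> e0; have [_ [v [r [h ->]]] /ltW le] := inf_adherent e0 E_inf.
by exists v, r.
Qed.

Let F : set_system H := filter_from [set e : R | 0 < e] A.

Let F_proper : ProperFilter F.
Proof.
apply: filter_from_proper; last by move=> e; exact: A_ne.
apply: filter_from_filter; first by exists 1 => /=.
move=> e e' /= e0 e'0; exists (Num.min e e'); first by rewrite /= lt_min e0.
move=> v [r h le]; split; exists r => //; apply: (le_trans le);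
  by rewrite lerD2l ge_min lexx ?orbT.
Qed.

(** The midpoint has [J] at least [m], and by the parallelogram law |v - v'|^2 / 2 = J(v) + J(v') -
    2 J(midpoint). *)
Let A_diam e v v' : A e v -> A e v' -> rnorm (v - v') ^+ 2 <= 4 * e.
Proof.
move=> [r h le] [r' h' le'].
have := m_le (rhol (2^-1 : R[i]) (rhol 1 h h') rho0).
rewrite /J addr0 scale1r mul1r addr0 rnormZ exprMn.
have -> : `|2^-1 : R[i]| = (2^-1 : R)%:C by rewrite ger0_norm ?invr_ge0 // fmorphV rmorph_nat.
have -> : (2^-1 : R[i]) = (2^-1 : R)%:C by rewrite fmorphV rmorph_nat.
rewrite (Re_dotD v v') Re_dotB; move: le le'; rewrite /J.
case: r {h} => a b; case: r' {h'} => a' b' /=; rewrite mul0r subr0.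
by move=> *; lra.
Qed.

Let w := lim F.

Let F_cvg : F --> w.
Proof.
have FF := F_proper; apply/cauchy_cvgP; apply: cauchy_exP => e; rewrite ltcE /= => /andP[/eqP ei e0].
have d0 : 0 < complex.Re e ^+ 2 / 8 by rewrite divr_gt0 // exprn_gt0.
have [v Av] := A_ne d0; exists v, (complex.Re e ^+ 2 / 8) => // v' Av'.
rewrite -ball_normE /= normE (_ : e = (complex.Re e)%:C); last first.
  by case: e ei {e0 d0 v Av Av'} => ? ? /= ->.
rewrite ltcR; have := A_diam Av Av'; have := rnorm_ge0 (v - v'); nra.
Qed.

Let w_approx (e : R) : 0 < e ->
  exists v r, [/\ rho v r, J v r <= m + e & rnorm (v - w) <= e].
Proof.
move=> e0; have : F (ball w e%:C) by apply: F_cvg; apply: nbhsx_ballx; rewrite ltcR.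
case=> d d0 h; have [|v [r hv le]] := @A_ne (Num.min d e).
  by rewrite lt_min e0 andbT.
exists v, r; split => //.
  by apply: (le_trans le); rewrite lerD2l ge_min lexx ?orbT.
have : A d v by exists r => //; apply: (le_trans le); rewrite lerD2l ge_min lexx.
by move=> /h; rewrite -ball_normE /= distrC normE ltcR => /ltW.
Qed.

(** The first variation of [J] at [w] in the direction [u]. As [w] is only a limit of vectors of the
    domain, the inequality is taken at a near-minimizer and the error is let go to 0. *)
Let var_ge0 u s (t : R) : rho u s ->
  0 <= 2 * t * (complex.Re ⟨u, w⟩ - complex.Re s) + t ^+ 2 * rnorm u ^+ 2.
Proof.
move=> us; set K := 1 + 2 * `|t| * rnorm u.
have K0 : 0 < K by rewrite ltr_pwDl // !mulr_ge0 // rnorm_ge0.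
apply/ler_addgt0Pl => d d0.
have [v [r [vr le vw]]] := @w_approx (d / K) ltac:(by rewrite divr_gt0).
have := m_le (rhol t%:C us vr).
rewrite /J Re_dotD rnormZ dotZl normc_def /= expr0n /= addr0 sqrtr_sqr.
rewrite exprMn real_normK ?num_real //.
move: (Re_dot_le u (v - w)) (Re_dot_le u (w - v)) le.
rewrite -(opprB v w) rnormN opprB !dotBr !raddfB /J /=.
case: (⟨u, v⟩) => a b; case: (⟨u, w⟩) => a' b' /=.
case: s {us} => sa sb; case: r {vr} => ra rb /=; rewrite !mul0r !subr0.
have: d = d / K * K by rewrite divfK // gt_eqF.
set e := d / K in vw *; rewrite /K => -> h1 h2 h3 h4.
have h5 : rnorm u * rnorm (v - w) <= rnorm u * e by rewrite ler_wpM2l // rnorm_ge0.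
have : `|t * (a - a')| <= `|t| * (rnorm u * e).
  rewrite normrM ler_wpM2l // ler_norml; apply/andP; split; lra.
by rewrite ler_norml => /andP[h6 h7]; nra.
Qed.

Let Re_eq u s : rho u s -> complex.Re ⟨u, w⟩ = complex.Re s.
Proof.
move=> us; apply/eqP; rewrite -subr_eq0; apply/eqP.
set X := _ - _; set U := rnorm u ^+ 2.
have U1 : 0 < U + 1 by rewrite ltr_wpDl // exprn_ge0 // rnorm_ge0.
(* The optimal t would be -X/U; the added 1 covers the case u = 0. *)
have := var_ge0 (- X / (U + 1)) us; rewrite -/X -/U.
have -> : 2 * (- X / (U + 1)) * X + (- X / (U + 1)) ^+ 2 * U =
    - (X ^+ 2 * ((U + 2) / (U + 1) ^+ 2)) by field; rewrite gt_eqF.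
rewrite oppr_ge0 pmulr_lle0; last by rewrite divr_gt0 ?exprn_gt0 //; lra.
by move=> h; apply/eqP; rewrite -sqrf_eq0 eq_le h sqr_ge0.
Qed.

(** Working with a graph lets the functional be prescribed on finite sums of tensors: the bound
    [rhoC] already makes its value independent of how a vector is written as a sum. *)
Lemma riesz : 0 <= C ->
  exists2 w : H, (forall v r, rho v r -> r = ⟨v, w⟩) & rnorm w <= C.
Proof.
move=> C0; exists w => [v r vr|].
  apply/eqP; rewrite eq_complex (Re_eq vr) eqxx /=.
  have := Re_eq (rhol 'i vr rho0); rewrite !addr0 dotZl.
  case: (r) => a b; case: (⟨v, w⟩) => c d /=.
  by rewrite !mul0r !mul1r !add0r => /oppr_inj ->.
suff : rnorm w * rnorm w <= C * rnorm w by have := rnorm_ge0 w; nra.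
apply/ler_addgt0Pl => d d0; set K := C + rnorm w + 1.
have K0 : 0 < K by rewrite ltr_wpDl // addr_ge0 // rnorm_ge0.
pose e := d / K; have e0 : 0 < e by rewrite divr_gt0.
have [v [r [vr _ vw]]] := w_approx e0.
have -> : d = e * K by rewrite /e divfK // gt_eqF.
rewrite /K; move: e e0 vw => e e0 vw.
have vw' : rnorm v <= rnorm w + e.
  rewrite -(subrK w v) -lecR -normE (le_trans (ler_normD _ _)) // !normE.
  by rewrite -rmorphD lecR (addrC (rnorm w)) lerD2r.
have : complex.Re ⟨v, w⟩ <= C * rnorm v.
  rewrite (Re_eq vr) (le_trans (ler_norm _)) // -lecR.
  by have := rhoC vr; rewrite normE -rmorphM; apply: le_trans (normc_ge_Re _).
have := Re_dot_le (w - v) w; rewrite dotBl raddfB /= -(opprB v w) rnormN.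
have -> : complex.Re ⟨w, w⟩ = rnorm w * rnorm w by rewrite dotxx expr2.
have h1 : C * rnorm v <= C * (rnorm w + e) by rewrite ler_wpM2l.
have h2 : rnorm (v - w) * rnorm w <= e * rnorm w by rewrite ler_wpM2r // rnorm_ge0.
by move: (rnorm_ge0 w) => h3 h4 h5; nra.
Qed.

End Riesz.

(** * Bounded operators *)

Section BoundedOperators.
Variable R : realType.
Implicit Types (H K L : hilbert R) (a : R[i]).

Definition bounded_by H K (f : H -> K) (c : R) :=
  forall x, rnorm (f x) <= c * rnorm x.

Lemma opnorm_leE H K (f : H -> K) (c : R) : opnorm_le f c%:C <-> bounded_by f c.
Proof. by split=> h x; have := h x; rewrite !normE -rmorphM lecR. Qed.

Lemma bopP H K (f : H -> K) :
  bop f <-> linear f /\ exists2 c : R, 0 <= c & bounded_by f c.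
Proof.
split=> [[fl fc]|[fl [c c0 fb]]]; split => //.
  pose F : {linear H -> K} := HB.pack f (GRing.isLinear.Build _ _ _ _ f fl).
  have /linear_bounded_continuous/linear_boundedP/pinfty_ex_gt0 [M M0 Mf] : continuous F by [].
  exists (complex.Re M); first by move: M0; rewrite ltcE => /andP[_ /ltW].
  apply/opnorm_leE; rewrite RRe_real // gtr0_real //.
pose F : {linear H -> K} := HB.pack f (GRing.isLinear.Build _ _ _ _ f fl).
apply: (@bounded_linear_continuous _ _ _ F); apply/linear_boundedP.
near=> M => x; have /opnorm_leE/(_ x) := fb => /le_trans; apply.
rewrite ler_wpM2r //; near: M; apply: nbhs_pinfty_ge.
by rewrite ger0_real // lecR.
Unshelve. all: by end_near. Qed.

Section LinearMaps.
Variables (H K : hilbert R) (f : H -> K).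
Hypothesis fb : bop f.

Lemma bop_linear : linear f. Proof. by case: fb. Qed.

Lemma bopD x y : f (x + y) = f x + f y.
Proof. by have := bop_linear 1 x y; rewrite !scale1r. Qed.

Lemma bop0 : f 0 = 0.
Proof. by apply: (addrI (f 0)); rewrite -bopD !addr0. Qed.

Lemma bopZ a x : f (a *: x) = a *: f x.
Proof. by have := bop_linear a x 0; rewrite bop0 !addr0. Qed.

Lemma bopN x : f (- x) = - f x.
Proof. by rewrite -scaleN1r bopZ scaleN1r. Qed.

Lemma bopB x y : f (x - y) = f x - f y.
Proof. by rewrite bopD bopN. Qed.

Lemma bop_bounded : exists2 c : R, 0 <= c & bounded_by f c.
Proof. by case/bopP: fb. Qed.

End LinearMaps.

Lemma rnormD H (x y : H) : rnorm (x + y) <= rnorm x + rnorm y.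
Proof. by rewrite -lecR rmorphD /= -!normE ler_normD. Qed.

Lemma bop_lin H K a (f g : H -> K) : bop f -> bop g -> bop (a *: f + g).
Proof.
move=> fb gb; apply/bopP; split.
  move=> c x y /=; rewrite !fctE !(bop_linear fb) !(bop_linear gb).
  by rewrite !scalerDr !scalerA mulrC addrACA.
have [c c0 fc] := bop_bounded fb; have [d d0 gd] := bop_bounded gb.
have a0 : 0 <= complex.Re `|a| by rewrite -lecR RRe_real //; exact: normr_ge0.
exists (complex.Re `|a| * c + d); first by rewrite addr_ge0 // mulr_ge0.
move=> x; rewrite (le_trans (rnormD _ _)) // mulrDl lerD // rnormZ -mulrA.
by rewrite ler_wpM2l.
Qed.

Lemma bop_zero H K : bop ((fun=> 0) : H -> K).
Proof.
apply/bopP; split; first by move=> c x y; rewrite scaler0 addr0.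
by exists 0 => // x; rewrite rnorm0 mul0r.
Qed.

Lemma bop_id H : bop (idfun : H -> H).
Proof. by apply/bopP; split => //; exists 1 => // x; rewrite mul1r. Qed.

Lemma bop_comp H K L (f : K -> L) (g : H -> K) : bop f -> bop g -> bop (f \o g).
Proof.
move=> fb gb; apply/bopP; split.
  by move=> c x y /=; rewrite (bop_linear gb) (bop_linear fb).
have [c c0 fc] := bop_bounded fb; have [d d0 gd] := bop_bounded gb.
exists (c * d) => [|x]; first exact: mulr_ge0.
by rewrite (le_trans (fc _)) // -mulrA ler_wpM2l.
Qed.

Lemma bop_add H K (f g : H -> K) : bop f -> bop g -> bop (f + g).
Proof. by move=> fb gb; rewrite -(scale1r f); apply: bop_lin. Qed.

Lemma bop_scale H K a (f : H -> K) : bop f -> bop (a *: f).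
Proof. by move=> fb; rewrite -(addr0 (a *: f)); apply: bop_lin => //; exact: bop_zero. Qed.

Lemma bop_sub H K (f g : H -> K) : bop f -> bop g -> bop (f - g).
Proof. by move=> fb gb; apply: bop_add => //; rewrite -scaleN1r; apply: bop_scale. Qed.

Lemma adj_ex H K (f : H -> K) : bop f ->
  exists g : K -> H, bop g /\ forall x y, ⟨f x, y⟩ = ⟨x, g y⟩.
Proof.
move=> fb; have [c c0 fc] := bop_bounded fb.
have /choice[g gP] y : exists w : H,
    (forall x, ⟨f x, y⟩ = ⟨x, w⟩) /\ rnorm w <= c * rnorm y.
  have [||||w h wc] := @riesz R H (fun x r => r = ⟨f x, y⟩) (c * rnorm y).
  - by rewrite bop0 // dot0l.
  - by move=> a v r v' r' -> ->; rewrite (bop_linear fb) dotDl dotZl.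
  - move=> v r ->; rewrite (le_trans (dot_le _ _)) // !normE -!rmorphM lecR.
    by rewrite mulrAC ler_wpM2r // rnorm_ge0.
  - by rewrite mulr_ge0 // rnorm_ge0.
  - by exists w; split => // x; apply: h.
exists g; split; last by move=> x y; case: (gP y).
apply/bopP; split; last by exists c => // y; case: (gP y).
move=> a x y; apply: dot_injr => z.
by rewrite dotDr dotZr -(gP x).1 -(gP y).1 -(gP _).1 dotDr dotZr.
Qed.

Section Adjoint.
Variables (H K : hilbert R) (f : H -> K).
Hypothesis fb : bop f.

Lemma adj_spec : bop (adj f) /\ forall x y, ⟨f x, y⟩ = ⟨x, adj f y⟩.
Proof. by rewrite /adj; case: xgetP => [g ->//|/(_ _)]; have [g h /(_ g)] := adj_ex fb. Qed.

Lemma bop_adj : bop (adj f). Proof. by case: adj_spec. Qed.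

Lemma adjP x y : ⟨f x, y⟩ = ⟨x, adj f y⟩. Proof. by case: adj_spec. Qed.

Lemma adjPl x y : ⟨adj f y, x⟩ = ⟨y, f x⟩.
Proof. by rewrite dotC -adjP -dotC. Qed.

Lemma adj_eq (g : K -> H) : (forall x y, ⟨f x, y⟩ = ⟨x, g y⟩) -> adj f = g.
Proof.
by move=> h; apply: funext => y; apply: dot_injr => x; rewrite -adjP h.
Qed.

End Adjoint.

Lemma adjK H K (f : H -> K) : bop f -> adj (adj f) = f.
Proof. by move=> fb; apply: adj_eq; [exact: bop_adj|move=> x y; rewrite adjPl]. Qed.

Lemma adj_comp H K L (f : K -> L) (g : H -> K) : bop f -> bop g ->
  adj (f \o g) = adj g \o adj f.
Proof.
by move=> fb gb; apply: adj_eq; [exact: bop_comp|move=> x y /=; rewrite !adjP].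
Qed.

Lemma adj_lin H K a (f g : H -> K) : bop f -> bop g ->
  adj (a *: f + g) = a^*%C *: adj f + adj g.
Proof.
move=> fb gb; apply: adj_eq; first exact: bop_lin.
by move=> x y; rewrite !fctE dotDl dotZl dotDr dotZr conjcK !adjP.
Qed.

Lemma adj_add H K (f g : H -> K) : bop f -> bop g -> adj (f + g) = adj f + adj g.
Proof. by move=> fb gb; have := adj_lin 1 fb gb; rewrite conjc1 !scale1r. Qed.

Lemma adj_zero H K : adj ((fun=> 0) : H -> K) = fun=> 0.
Proof. by apply: adj_eq; [exact: bop_zero|move=> x y; rewrite dot0l dot0r]. Qed.

Lemma adj_scale H K a (f : H -> K) : bop f -> adj (a *: f) = a^*%C *: adj f.
Proof.
move=> fb; apply: adj_eq; first exact: bop_scale.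
by move=> x y; rewrite dotZl adjP // dotZr conjcK.
Qed.

Lemma adj_sub H K (f g : H -> K) : bop f -> bop g -> adj (f - g) = adj f - adj g.
Proof.
move=> fb gb; apply: adj_eq; first exact: bop_sub.
by move=> x y; rewrite dotBl !adjP // dotBr.
Qed.

Lemma adj_id H : adj (idfun : H -> H) = idfun.
Proof. by apply: adj_eq; [exact: bop_id|]. Qed.

(* The bounded extension is the adjoint of the operator sending y to the Riesz
   vector of the functional v ↦ ⟨w, y⟩. *)
Lemma bop_extension H K (rho : H -> K -> Prop) (c : R) : 0 <= c -> rho 0 0 ->
  (forall a v w v' w', rho v w -> rho v' w' -> rho (a *: v + v') (a *: w + w')) ->
  (forall v w, rho v w -> rnorm w <= c * rnorm v) ->
  (forall y, (forall v w, rho v w -> ⟨v, y⟩ = 0) -> y = 0) ->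
  exists2 f : H -> K, bop f & forall v w, rho v w -> f v = w.
Proof.
move=> c0 r0 rl rc rt.
have /choice[g gP] y : exists u : H,
    (forall v w, rho v w -> ⟨w, y⟩ = ⟨v, u⟩) /\ rnorm u <= c * rnorm y.
  have [||||u h uc] :=
    @riesz R H (fun v r => exists2 w, rho v w & r = ⟨w, y⟩) (c * rnorm y).
  - by exists 0; rewrite ?dot0l.
  - move=> a v _ v' _ [w vw ->] [w' vw' ->].
    by exists (a *: w + w'); [exact: rl | rewrite dotDl dotZl].
  - move=> v _ [w vw ->]; rewrite (le_trans (dot_le _ _)) // !normE -!rmorphM lecR.
    by rewrite mulrAC ler_wpM2r // ?rnorm_ge0 // rc.
  - by rewrite mulr_ge0 // rnorm_ge0.
  - by exists u; split => // v w vw; apply: h; exists w.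
have gE y v w : rho v w -> ⟨w, y⟩ = ⟨v, g y⟩ by case: (gP y) => h _ /h.
have gb : bop g.
  apply/bopP; split; last by exists c => // y; case: (gP y).
  move=> a x y; apply/eqP; rewrite -subr_eq0; apply/eqP; apply: rt => v w vw.
  by rewrite dotBr dotDr dotZr -!(gE _ _ _ vw) dotDr dotZr subrr.
exists (adj g); first exact: bop_adj.
by move=> v w vw; apply: dot_injr => y; rewrite -adjP // dotC -(gE y v w) // -dotC.
Qed.

Lemma opclosureP H K (A : set (H -> K)) (x : H -> K) : opclosure A x <->
  bop x /\ forall e : R, 0 < e -> exists2 a, A a & bounded_by (x - a) e.
Proof.
split=> -[xb h]; split => // e e0.
  have [|a Aa ae] := h e%:C; first by rewrite ltcR.
  by exists a => //; apply/opnorm_leE.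
move: e0; rewrite ltcE => /andP[/eqP ei /h [a Aa ae]]; exists a => //.
rewrite (_ : e = (complex.Re e)%:C); first exact/opnorm_leE.
by case: e ei {h ae} => ? ? /= ->.
Qed.

End BoundedOperators.

(** * Tensor products *)

Section GramSchmidt.
Variables (R : realType) (H K : hilbert R).

Definition bilin (V : lmodType R[i]) (F : H -> K -> V) : Prop :=
  (forall a x x' y, F (a *: x + x') y = a *: F x y + F x' y) /\
  (forall a x y y', F x (a *: y + y') = a *: F x y + F x y').

Fixpoint orthonormal_fst (s : seq (H * K)) : Prop :=
  if s is p :: s' then
    [/\ ⟨p.1, p.1⟩ = 1, forall q, q \in s' -> ⟨p.1, q.1⟩ = 0 & orthonormal_fst s']
  else True.

Section Bilinear.
Variables (V : lmodType R[i]) (F : H -> K -> V).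
Hypothesis Fb : bilin F.

Lemma bilinDl x x' y : F (x + x') y = F x y + F x' y.
Proof. by have := Fb.1 1 x x' y; rewrite !scale1r. Qed.
Lemma bilinDr x y y' : F x (y + y') = F x y + F x y'.
Proof. by have := Fb.2 1 x y y'; rewrite !scale1r. Qed.
Lemma bilin0l y : F 0 y = 0.
Proof. by apply: (addrI (F 0 y)); rewrite -bilinDl !addr0. Qed.
Lemma bilin0r x : F x 0 = 0.
Proof. by apply: (addrI (F x 0)); rewrite -bilinDr !addr0. Qed.
Lemma bilinZl a x y : F (a *: x) y = a *: F x y.
Proof. by have := Fb.1 a x 0 y; rewrite bilin0l !addr0. Qed.
Lemma bilinZr a x y : F x (a *: y) = a *: F x y.
Proof. by have := Fb.2 a x y 0; rewrite bilin0r !addr0. Qed.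
Lemma bilin_suml I (r : seq I) (f : I -> H) y :
  F (\sum_(i <- r) f i) y = \sum_(i <- r) F (f i) y.
Proof. by apply: (big_morph (F^~ y)) => [x x'|]; rewrite ?bilinDl ?bilin0l. Qed.
End Bilinear.

Let proj (t : seq (H * K)) x := \sum_(q <- t) ⟨x, q.1⟩ *: q.1.

Lemma orthonormal_proj t x q : orthonormal_fst t -> q \in t ->
  ⟨proj t x, q.1⟩ = ⟨x, q.1⟩.
Proof.
rewrite /proj; elim: t => //= p t IH [p1 pt ont].
rewrite big_cons dotDl dotZl inE => /predU1P[->|qt]; last first.
  by rewrite pt // mulr0 add0r IH.
rewrite p1 mulr1 dot_suml big_seq big1 ?addr0 // => r rt.
by rewrite dotZl (dotC r.1) pt // conjc0 mulr0.
Qed.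

Lemma orthonormal_map t (f : H * K -> K) : orthonormal_fst t ->
  orthonormal_fst [seq (q.1, f q) | q <- t].
Proof.
elim: t => //= p t IH [p1 pt ont]; split => //; last exact: IH.
by move=> _ /mapP[q qt ->] /=; apply: pt.
Qed.

Lemma gram_schmidt (s : seq (H * K)) : exists2 t, orthonormal_fst t &
  forall (V : lmodType R[i]) (F : H -> K -> V), bilin F ->
    \sum_(p <- s) F p.1 p.2 = \sum_(p <- t) F p.1 p.2.
Proof.
elim: s => [|[x y] s [t ont IH]]; first by exists [::].
pose r := x - proj t x.
pose t' := [seq (q.1, q.2 + ⟨x, q.1⟩ *: y) | q <- t].
have ont' : orthonormal_fst t' by exact: orthonormal_map.
have sumt' (V : lmodType R[i]) (F : H -> K -> V) : bilin F ->
    \sum_(p <- (x, y) :: s) F p.1 p.2 = F r y + \sum_(p <- t') F p.1 p.2.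
  move=> Fb; rewrite big_cons (IH V F) // big_map /=.
  under [in RHS]eq_bigr do rewrite (bilinDr Fb) (bilinZr Fb) -(bilinZl Fb).
  by rewrite big_split /= -(bilin_suml Fb) addrCA -(bilinDl Fb) subrK addrC.
have rt q : q \in t -> ⟨r, q.1⟩ = 0.
  by move=> qt; rewrite /r dotBl orthonormal_proj // subrr.
have [r0|r0] := eqVneq r 0.
  by exists t' => // V F Fb; rewrite sumt' // r0 (bilin0l Fb) add0r.
have nr0 : `|r| != 0 by rewrite normr_eq0.
exists ((`|r|^-1 *: r, `|r| *: y) :: t') => [/=|V F Fb]; last first.
  by rewrite sumt' // [in RHS]big_cons /= (bilinZl Fb) (bilinZr Fb) scalerA mulVf // scale1r.
split => //; last by move=> _ /mapP[q qt ->] /=; rewrite dotZl rt // mulr0.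
rewrite -/(GRing.scale _ _) hdot_norm normrZ normrV ?unitfE // normr_id mulVf //.
by rewrite expr1n.
Qed.

End GramSchmidt.

Section TensorNorm.
Variables (R : realType) (H K L : hilbert R) (F : H -> K -> L).
Hypothesis Fb : bilin F.
Hypothesis Fdot : forall x x' y y', ⟨F x y, F x' y'⟩ = ⟨x, x'⟩ * ⟨y, y'⟩.

Lemma rnorm_orthonormal (t : seq (H * K)) : orthonormal_fst t ->
  rnorm (\sum_(p <- t) F p.1 p.2) ^+ 2 = \sum_(p <- t) rnorm p.2 ^+ 2.
Proof.
elim: t => [_|p t IH [p1 pt ont]]; first by rewrite !big_nil rnorm0 expr0n.
have z : ⟨\sum_(q <- t) F q.1 q.2, F p.1 p.2⟩ = 0.
  rewrite dot_suml big_seq big1 // => q qt.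
  by rewrite Fdot dotC pt // conjc0 mul0r.
rewrite !big_cons Re_dotD IH // Re_dotC z mulr0 addr0; congr (_ + _).
by apply: complexI; rewrite -!dotxx Fdot p1 mul1r.
Qed.

(** Once the first legs are orthonormal, Pythagoras computes both norms and the inequality holds
    term by term. *)
Lemma tensor_bound (b : K -> K) (c : R) (s : seq (H * K)) : 0 <= c ->
  linear b -> bounded_by b c ->
  rnorm (\sum_(p <- s) F p.1 (b p.2)) <= c * rnorm (\sum_(p <- s) F p.1 p.2).
Proof.
move=> c0 bl bc; have [t ont st] := gram_schmidt s.
have Gb : bilin (fun x y => F x (b y)).
  by split=> *; rewrite ?bl ?(bilinDl Fb) ?(bilinDr Fb) ?(bilinZl Fb) ?(bilinZr Fb).
rewrite (st _ _ Gb) (st _ _ Fb) -(ler_pXn2r (n := 2)) ?nnegrE ?mulr_ge0 ?rnorm_ge0 //.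
have := rnorm_orthonormal (orthonormal_map (fun q => b q.2) ont).
rewrite !big_map /= => ->; rewrite exprMn rnorm_orthonormal // mulr_sumr.
by apply: ler_sum => p _; rewrite -exprMn lerXn2r // nnegrE ?mulr_ge0 ?rnorm_ge0.
Qed.

End TensorNorm.

Section Tensors.
Variables (R : realType) (H K : hilbert R) (T : htensor H K).

Lemma tens_bilin : bilin (tens T).
Proof.
split=> [a x x' y|a x y y'].
  by rewrite linearDl linearZl_LR.
rewrite linearDr; congr (_ + _); exact: linearZr_LR.
Qed.

Lemma rnorm_tens x y : rnorm (tens T x y) = rnorm x * rnorm y.
Proof.
apply/eqP; rewrite -(eqrXn2 (n := 2)) ?mulr_ge0 ?rnorm_ge0 //; apply/eqP.
apply: complexI; rewrite -dotxx tens_dot !dotxx exprMn.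
by rewrite -rmorphM.
Qed.

Lemma bop_tens x : bop (tens T x).
Proof.
apply/bopP; split; first by move=> *; exact: tens_bilin.2.
by exists (rnorm x) => [|y]; rewrite ?rnorm_ge0 ?rnorm_tens.
Qed.

Lemma bop_tensr y : bop (fun x => tens T x y).
Proof.
apply/bopP; split; first by move=> a u v; exact: (tens_bilin.1 a u v y).
by exists (rnorm y) => [|x]; rewrite ?rnorm_ge0 ?rnorm_tens // mulrC.
Qed.

Lemma adj_tens x x' y : adj (tens T x) (tens T x' y) = ⟨x', x⟩ *: y.
Proof.
by apply: dot_inj => z; rewrite (adjPl (bop_tens x)) tens_dot dotZl.
Qed.

Lemma rnorm_adj_tens x w : rnorm (adj (tens T x) w) <= rnorm x * rnorm w.
Proof.
set z := adj _ _; have := Re_dot_le (tens T x z) w.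
rewrite (adjP (bop_tens x)) -/z dotxx /= rnorm_tens => h.
have [z0|/eqP z0] := eqVneq (rnorm z) 0; first by rewrite z0 mulr_ge0 ?rnorm_ge0.
have zp : 0 < rnorm z by rewrite lt_neqAle rnorm_ge0 andbT eq_sym; apply/eqP.
by rewrite -(ler_pM2l zp); move: h; rewrite expr2 mulrCA mulrA.
Qed.

Lemma tens_ortho0 z : (forall x y, ⟨tens T x y, z⟩ = 0) -> z = 0.
Proof.
move=> h; apply: (dense_ortho0 (@tens_total _ _ _ T)) => _ [x [y ->]].
exact: h.
Qed.

Lemma bop_tens_inj (L : hilbert R) (f g : T -> L) : bop f -> bop g ->
  (forall x y, f (tens T x y) = g (tens T x y)) -> f = g.
Proof.
move=> fb gb h; apply: funext => v; apply: dot_injr => z.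
rewrite -(adjK fb) -(adjK gb) -!adjP ?bop_adj //; try exact: bop_adj.
congr (⟨_, _⟩); apply/eqP; rewrite -subr_eq0; apply/eqP; apply: tens_ortho0 => x y.
by rewrite dotBr -!adjP // h subrr.
Qed.

(** Since a ⊗ b = (1 ⊗ b)(a ⊗ 1), [tensor_bound] is applied once per leg, the second time with the
    two factors exchanged. *)
Lemma tensop_ex (a : H -> H) (b : K -> K) : bop a -> bop b ->
  exists x : T -> T, bop x /\
    forall xi eta, x (tens T xi eta) = tens T (a xi) (b eta).
Proof.
move=> ab bb; have [ca ca0 ac] := bop_bounded ab; have [cb cb0 bc] := bop_bounded bb.
pose rho (v w : T) := exists s : seq (H * K), v = \sum_(p <- s) tens T p.1 p.2 /\
  w = \sum_(p <- s) tens T (a p.1) (b p.2).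
have [||||f fb fE] := @bop_extension R T T rho (cb * ca) (mulr_ge0 cb0 ca0).
- by exists [::]; rewrite !big_nil.
- move=> c _ _ _ _ [s [-> ->]] [s' [-> ->]].
  exists ([seq (c *: p.1, p.2) | p <- s] ++ s'); rewrite !big_cat !big_map /=.
  split; congr (_ + _); rewrite scaler_sumr; apply: eq_bigr => p _.
    by rewrite linearZl_LR.
  by rewrite (bopZ ab) linearZl_LR.
- move=> _ _ [s [-> ->]].
  have := tensor_bound tens_bilin (@tens_dot _ _ _ T) [seq (a p.1, p.2) | p <- s]
    cb0 (bop_linear bb) bc.
  rewrite !big_map /= => /le_trans; apply; rewrite -mulrA ler_wpM2l //.
  have sb : bilin (fun y x => tens T x y).
    by split=> *; [move: tens_bilin => [_ +]; exact | move: tens_bilin => [+ _]; exact].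
  have sd y y' x x' : ⟨tens T x y, tens T x' y'⟩ = ⟨y, y'⟩ * ⟨x, x'⟩ by rewrite tens_dot mulrC.
  have := tensor_bound sb sd [seq (p.2, p.1) | p <- s] ca0 (bop_linear ab) ac.
  by rewrite !big_map.
- move=> y h; apply: tens_ortho0 => x z; apply: (h _ (tens T (a x) (b z))).
  by exists [:: (x, z)]; rewrite !big_seq1.
- exists f; split => // x y; apply: fE.
  by exists [:: (x, y)]; rewrite !big_seq1.
Qed.

Section TensOp.
Variables (a : H -> H) (b : K -> K).
Hypotheses (ab : bop a) (bb : bop b).

Let tensop_spec : bop (tensop T a b) /\
  forall xi eta, tensop T a b (tens T xi eta) = tens T (a xi) (b eta).
Proof. by rewrite /tensop; case: xgetP => [g ->//|]; have [g h /(_ g)] := tensop_ex ab bb. Qed.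

Lemma bop_tensop : bop (tensop T a b). Proof. by case: tensop_spec. Qed.

Lemma tensopE x y : tensop T a b (tens T x y) = tens T (a x) (b y).
Proof. by case: tensop_spec. Qed.

End TensOp.

Lemma adj_tensop a b : bop a -> bop b ->
  adj (tensop T a b) = tensop T (adj a) (adj b).
Proof.
move=> ab bb; have [ab' bb'] := (bop_adj ab, bop_adj bb).
apply: bop_tens_inj; [exact/bop_adj/bop_tensop|exact: bop_tensop|move=> x y].
apply/eqP; rewrite -subr_eq0; apply/eqP; apply: tens_ortho0 => x' y'.
rewrite dotBr -adjP; last exact: bop_tensop.
by rewrite !tensopE // !tens_dot !adjP // subrr.
Qed.

Lemma dot_orthonormal (t : seq (H * K)) (f : H * K -> K) : orthonormal_fst t ->
  ⟨\sum_(p <- t) tens T p.1 p.2, \sum_(p <- t) tens T p.1 (f p)⟩ =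
  \sum_(p <- t) ⟨p.2, f p⟩ :> R[i].
Proof.
elim: t => [|p t IH] /=; first by rewrite !big_nil dot0l.
move=> [p1 pt ont]; have z (g : H * K -> K) y :
    ⟨\sum_(q <- t) tens T q.1 (g q), tens T p.1 y⟩ = 0.
  rewrite dot_suml big_seq big1 // => q qt.
  by rewrite tens_dot dotC pt // conjc0 mul0r.
rewrite !big_cons dotDl !dotDr IH // tens_dot p1 mul1r z.
by rewrite [⟨tens T p.1 p.2, _⟩]dotC z conjc0 addr0 add0r.
Qed.

(** The vector v = Σ e ⊗ t_e^* w, over the first legs e of [t], is a projection of w: ⟨v, w⟩ =
    |v|^2, and the inequality is |v - w|^2 ≥ 0 expanded. *)
Lemma bessel (t : seq (H * K)) (w : T) : orthonormal_fst t ->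
  \sum_(p <- t) rnorm (adj (tens T p.1) w) ^+ 2 <= rnorm w ^+ 2.
Proof.
move=> ont; have ont' := orthonormal_map (fun q => adj (tens T q.1) w) ont.
pose v := \sum_(p <- t) tens T p.1 (adj (tens T p.1) w).
have vn : rnorm v ^+ 2 = \sum_(p <- t) rnorm (adj (tens T p.1) w) ^+ 2.
  by have := rnorm_orthonormal (@tens_dot _ _ _ T) ont'; rewrite !big_map.
rewrite -vn -subr_ge0; have := sqr_ge0 (rnorm (v - w)); rewrite Re_dotB.
suff -> : complex.Re ⟨v, w⟩ = rnorm v ^+ 2 by lra.
rewrite vn dot_suml raddf_sum /=; apply: eq_bigr => p _.
by rewrite adjP ?dotxx //; apply: bop_tens.
Qed.

End Tensors.

(** * Weights *)

Section ParallelogramLaw.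
Variables (R : realType) (V : lmodType R[i]) (P : set V) (d : V -> R).
Hypothesis Plin : forall a x y, P x -> P y -> P (a *: x + y).
Hypothesis P0 : P 0.
Hypothesis dpar : forall x y, P x -> P y -> d (x + y) + d (x - y) = 2 * d x + 2 * d y.
Hypothesis di : forall x, P x -> d ('i *: x) = d x.

Let PD x y : P x -> P y -> P (x + y).
Proof. by move=> Px Py; rewrite -(scale1r x); apply: Plin. Qed.

Let PN x : P x -> P (- x).
Proof. by move=> Px; rewrite -(addr0 (- x)) -scaleN1r; apply: Plin. Qed.

Let d0 : d 0 = 0.
Proof. by have := dpar P0 P0; rewrite subr0 addr0; lra. Qed.

(** This is the additivity of the polarization d(x + y) - d(x) - d(y) in each variable, the part of
    the Jordan-von Neumann argument that requires no continuity. *)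
Let d3 x y z : P x -> P y -> P z ->
  d (x + y + z) = d (x + y) + d (y + z) + d (x + z) - d x - d y - d z.
Proof.
move=> Px Py Pz.
have h1 := dpar (PD Px Pz) Py; have h2 := dpar (PD Px (PN Py)) Pz.
have h3 := dpar Px (PD Py Pz); have h4 := dpar Px Py.
move: h1 h2 h3; rewrite (addrAC x z y) (addrAC x z (- y)).
rewrite (_ : x - y - z = x - (y + z)); last by rewrite opprD addrA.
by rewrite (addrA x y z); move: h4; lra.
Qed.

Variables (A B : lmodType R[i]) (Q : set B) (S : A -> B -> V).
Hypothesis Qlin : forall a x y, Q x -> Q y -> Q (a *: x + y).
Hypothesis Q0 : Q 0.
Hypothesis SP : forall f b, Q b -> P (S f b).
Hypothesis Sl : forall a f g b, Q b -> S (a *: f + g) b = a *: S f b + S g b.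
Hypothesis Sr : forall a f b c, Q b -> Q c -> S f (a *: b + c) = a *: S f b + S f c.
Hypothesis dS : forall f b, Q b -> d (S f b) = 0.

Let SDl f g b : Q b -> S (f + g) b = S f b + S g b.
Proof. by move=> Qb; have := Sl 1 f g Qb; rewrite !scale1r. Qed.

Let SDr f b c : Q b -> Q c -> S f (b + c) = S f b + S f c.
Proof. by move=> Qb Qc; have := Sr 1 f Qb Qc; rewrite !scale1r. Qed.

Let QD b c : Q b -> Q c -> Q (b + c).
Proof. by move=> Qb Qc; rewrite -(scale1r b); apply: Qlin. Qed.

Let QZ a b : Q b -> Q (a *: b).
Proof. by move=> Qb; rewrite -(addr0 (a *: b)); apply: Qlin. Qed.

Let S0l b : Q b -> S 0 b = 0.
Proof. by move=> Qb; apply: (addrI (S 0 b)); rewrite -SDl // !addr0. Qed.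

Let S0r f : S f 0 = 0.
Proof. by apply: (addrI (S f 0)); rewrite -SDr // !addr0. Qed.

Let SZl a f b : Q b -> S (a *: f) b = a *: S f b.
Proof. by move=> Qb; rewrite -[a *: f]addr0 Sl // S0l // addr0. Qed.

Let SZr a f b : Q b -> S f (a *: b) = a *: S f b.
Proof. by move=> Qb; rewrite -[a *: b]addr0 Sr // S0r addr0. Qed.

Let D f a g b := d (S f a + S g b).

(** Expand d(S (f + g) (a + b)) = 0 into pairs: a pair sharing f, g, a or b sums to an elementary
    tensor and contributes 0, which leaves the two crossed pairs. *)
Let D_swap f a g b : Q a -> Q b -> D f a g b + D f b g a = 0.
Proof.
move=> Qa Qb; have := dS (f + g) (QD Qa Qb).
rewrite SDl ?SDr //; last exact: QD.
have [fa fb ga gb] : [/\ P (S f a), P (S f b), P (S g a) & P (S g b)].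
  by split; apply: SP.
have e1 h : d (S h a + S h b) = 0 by rewrite -SDr // dS //; apply: QD.
have e2 c : Q c -> d (S f c + S g c) = 0 by move=> Qc; rewrite -SDl // dS.
rewrite d3 //; last exact: PD.
rewrite addrA [S f a + (_ + _)]addrA !d3 // !e1 !e2 // !dS // /D.
by lra.
Qed.

(** [D_swap] says that exchanging a and b changes the sign. Multiplying f and b by i turns the same
    relation into symmetry under the exchange: i S f a + i S g b = S (if) a + S g (ib), while S (if)
    (ib) = - S f b and the parallelogram law reverses the sign of [D]. Hence both terms vanish. *)
Let D_0 f a g b : Q a -> Q b -> D f a g b = 0.
Proof.
move=> Qa Qb; have h := D_swap f g Qa Qb.
have h1 : D f a g b = D ('i *: f) a g ('i *: b).
  by rewrite /D SZl // SZr // -scalerDr di //; apply: PD; apply: SP.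
have h2 := D_swap ('i *: f) g Qa (QZ 'i Qb).
have h3 : D ('i *: f) ('i *: b) g a = - D f b g a.
  rewrite /D SZr // SZl //.
  rewrite scalerA -expr2 sqr_i scaleN1r addrC.
  have := dpar (SP g Qa) (SP f Qb); rewrite !dS // (addrC _ (S f b)); lra.
by move: h h1 h2 h3; lra.
Qed.

(** The induction carries the vanishing for the sum with one more elementary tensor added, because
    [d3] reduces three summands to pairs. *)
Lemma parallelogram_vanish (s : seq (A * B)) : (forall p, p \in s -> Q p.2) ->
  d (\sum_(p <- s) S p.1 p.2) = 0.
Proof.
move=> Qs; suff [] : [/\ P (\sum_(p <- s) S p.1 p.2),
  d (\sum_(p <- s) S p.1 p.2) = 0 &
  forall f b, Q b -> d (S f b + \sum_(p <- s) S p.1 p.2) = 0] by [].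
elim: s Qs => [|p s IH] Qs.
  by rewrite big_nil; split => // f b Qb; rewrite addr0 dS.
have Qp : Q p.2 by apply: Qs; rewrite mem_head.
have [|Ps ds dfs] := IH; first by move=> q qs; apply: Qs; rewrite inE qs orbT.
rewrite big_cons; split; [exact/PD/Ps/SP | exact: dfs |].
move=> f b Qb; rewrite addrA (d3 (SP f Qb) (SP _ Qp) Ps) !dfs // ds !dS //.
by have := D_0 f p.1 Qb Qp; rewrite /D => ->; lra.
Qed.

End ParallelogramLaw.

Section VonNeumann.
Variables (R : realType) (H : hilbert R).
Implicit Types (A M : set (H -> H)).

Lemma commutant_lin A (a : R[i]) x y : (forall z, A z -> bop z) ->
  commutant A x -> commutant A y -> commutant A (a *: x + y).
Proof.
move=> Ab [xb xc] [yb yc]; split; first exact: bop_lin.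
move=> z Az; apply: funext => v /=; have zb := Ab _ Az; rewrite !fctE.
have := congr1 (@^~ v) (xc _ Az); have := congr1 (@^~ v) (yc _ Az) => /= -> ->.
by rewrite (bop_linear zb).
Qed.

Lemma commutant_id A : commutant A idfun.
Proof. by split; first exact: bop_id. Qed.

Variable M : set (H -> H).
Hypothesis MN : von_neumann M.

Lemma commutant_adj x : commutant M x -> commutant M (adj x).
Proof.
move=> [xb xc]; split; first exact: bop_adj.
move=> y My; have yb := vn_bop MN My; have My' := vn_adj MN My.
have := adj_comp (bop_adj yb) xb; have := adj_comp xb (bop_adj yb).
by rewrite (adjK yb) (xc _ My') => <- <-.
Qed.

Lemma vnP x : M x <-> bop x /\ forall y, commutant M y -> x \o y = y \o x.
Proof. by rewrite -{1}(vn_bicommutant MN). Qed.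

Lemma vn_id : M idfun.
Proof. by rewrite -(vn_bicommutant MN); exact: commutant_id. Qed.

Lemma vn_lin (a : R[i]) x y : M x -> M y -> M (a *: x + y).
Proof. by rewrite -(vn_bicommutant MN); apply: commutant_lin => z []. Qed.

Lemma vn_0 : M 0.
Proof. by have := vn_lin (-1) vn_id vn_id; rewrite scaleN1r addNr. Qed.

Lemma vn_add x y : M x -> M y -> M (x + y).
Proof. by move=> Mx My; rewrite -(scale1r x); apply: vn_lin. Qed.

Lemma vn_scale (a : R[i]) x : M x -> M (a *: x).
Proof. by move=> Mx; rewrite -(addr0 (a *: x)); apply: vn_lin => //; exact: vn_0. Qed.

End VonNeumann.

(** * A weight as a quadratic form on intertwiners *)

Section Weights.
Variables (R : realType) (H : hilbert R) (M : set (H -> H)).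
Hypothesis MN : von_neumann M.
Variable phi : (H -> H) -> \bar R.
Hypothesis phiw : nsf_weight M phi.

Lemma pos0 : pos M 0.
Proof. by split; [exact: vn_0 | move=> x; rewrite dot0l]. Qed.

Lemma posD x y : pos M x -> pos M y -> pos M (x + y).
Proof.
move=> [Mx px] [My py]; split; first exact: vn_add.
by move=> v; rewrite dotDl addr_ge0.
Qed.

Lemma posZ (r : R) x : 0 <= r -> pos M x -> pos M (r%:C *: x).
Proof.
move=> r0 [Mx px]; split; first exact: vn_scale.
by move=> v; rewrite dotZl mulr_ge0 // lecR.
Qed.

Lemma weight0 : phi 0 = 0%E.
Proof. by have := wt_scale phiw (lexx 0) pos0; rewrite scaler0 mul0e. Qed.

Lemma weight_le x y : pos M x -> pos M y -> leop x y -> (phi x <= phi y)%E.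
Proof.
move=> px py xy; have pyx : pos M (y - x).
  split; last by move=> v; rewrite dotBl subr_ge0.
  by rewrite -scaleN1r addrC; apply: vn_lin => //; [case: px | case: py].
rewrite -(subrK x y) (wt_add phiw) // leeDr //; exact: wt_ge0 phiw _ pyx.
Qed.

Section SquareIntegrable.
Variables (X : hilbert R) (act : (H -> H) -> (X -> X)).
Hypothesis act_bop : forall x, commutant M x -> bop (act x).
Hypothesis act_adj : forall x, commutant M x -> adj (act x) = act (adj x).

(** With X = H and [act] the identity these are the elements of M, by the bicommutant property; with
    X = H ⊗ H and x acting as 1 ⊗ x they include the operators Δ(b) t_f. In both cases T^* T lies in
    M, where φ can be evaluated. *)
Definition intertwiner (T : H -> X) : Prop :=
  bop T /\ forall x, commutant M x -> T \o x = act x \o T.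

Definition sq_integrable (T : H -> X) : Prop :=
  intertwiner T /\ (phi (adj T \o T) < +oo)%E.

Definition sq_weight (T : H -> X) : R := fine (phi (adj T \o T)).

Lemma intertwiner_adj T x : intertwiner T -> commutant M x ->
  adj T \o act x = x \o adj T.
Proof.
move=> [Tb Tc] cx; have cx' := commutant_adj MN cx; have [xb _] := cx.
have := adj_comp (act_bop cx') Tb; have := adj_comp Tb (bop_adj xb).
by rewrite (adjK xb) act_adj // (adjK xb) -(Tc _ cx') => -> ->.
Qed.

Lemma intertwiner_mul T S : intertwiner T -> intertwiner S -> M (adj T \o S).
Proof.
move=> hT hS; apply/(vnP MN); split.
  by apply: bop_comp; [apply: bop_adj|]; case: hT hS => ? _ [].
move=> x cx; rewrite -compA (hS.2 _ cx) compA intertwiner_adj //.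
Qed.

Lemma intertwiner_lin a T S : intertwiner T -> intertwiner S ->
  intertwiner (a *: T + S).
Proof.
move=> [Tb Tc] [Sb Sc]; split; first exact: bop_lin.
move=> x cx; apply: funext => v /=; rewrite !fctE.
have := congr1 (@^~ v) (Tc _ cx); have := congr1 (@^~ v) (Sc _ cx) => /= -> ->.
by rewrite (bop_linear (act_bop cx)).
Qed.

Lemma intertwiner_pos T : intertwiner T -> pos M (adj T \o T).
Proof.
move=> hT; split; first exact: intertwiner_mul.
by move=> v /=; rewrite adjPl ?hdot_norm ?exprn_ge0 //; case: hT.
Qed.

Lemma sq_weightE T : sq_integrable T -> phi (adj T \o T) = (sq_weight T)%:E.
Proof.
move=> [iT fT]; rewrite fineK // ge0_fin_numE //.
exact/(wt_ge0 phiw)/intertwiner_pos.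
Qed.

Lemma sq_weight_ge0 T : intertwiner T -> 0 <= sq_weight T.
Proof. by move=> iT; apply/fine_ge0/(wt_ge0 phiw)/intertwiner_pos. Qed.

Lemma sqZ a (T : H -> X) : bop T ->
  adj (a *: T) \o (a *: T) = (complex.Re `|a| ^+ 2)%:C *: (adj T \o T : H -> H).
Proof.
move=> Tb; apply: funext => v; rewrite adj_scale //= !fctE (bopZ (bop_adj Tb)) scalerA.
congr (_ *: _); rewrite mulrC -sqr_normc (rmorphXn (real_complex R)).
by [].
Qed.

Lemma sq_parallelogram (T S : H -> X) : bop T -> bop S ->
  (adj (T + S) \o (T + S) : H -> H) + (adj (T - S) \o (T - S)) =
  (2 : R)%:C *: (adj T \o T : H -> H) + (2 : R)%:C *: (adj S \o S : H -> H).
Proof.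
move=> Tb Sb; apply: funext => v; rewrite adj_add // adj_sub // /= !fctE /=.
rewrite !(bopD (bop_adj Tb)) !(bopD (bop_adj Sb)).
rewrite !(bopN (bop_adj Tb)) !(bopN (bop_adj Sb)) (_ : (2 : R)%:C = 2); last first.
  by rewrite rmorph_nat.
apply: dot_inj => z; rewrite !(dotDl, dotZl, dotNl); ring.
Qed.

Lemma intertwinerB T S : intertwiner T -> intertwiner S -> intertwiner (T - S).
Proof. by move=> iT iS; rewrite -scaleN1r addrC; exact: intertwiner_lin. Qed.

Lemma intertwinerD T S : intertwiner T -> intertwiner S -> intertwiner (T + S).
Proof. by move=> iT iS; rewrite -(scale1r T); exact: intertwiner_lin. Qed.

Lemma weight_parallelogram T S : intertwiner T -> intertwiner S ->
  (phi (adj (T + S)%R \o (T + S)%R) + phi (adj (T - S)%R \o (T - S)%R) =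
   2%:E * phi (adj T \o T) + 2%:E * phi (adj S \o S))%E.
Proof.
move=> iT iS; have [pT pS] := (intertwiner_pos iT, intertwiner_pos iS).
rewrite -(wt_add phiw); try by apply: intertwiner_pos; [exact: intertwinerD|exact: intertwinerB].
- rewrite sq_parallelogram ?(wt_add phiw) ?(wt_scale phiw) //; try exact: posZ.
  + by case: iT.
  + by case: iS.
- exact/intertwiner_pos/intertwinerD.
- exact/intertwiner_pos/intertwinerB.
Qed.

Lemma weightZ a T : intertwiner T ->
  phi (adj (a *: T) \o (a *: T)) = ((complex.Re `|a| ^+ 2)%R%:E * phi (adj T \o T))%E.
Proof.
move=> iT; rewrite sqZ ?(wt_scale phiw) ?sqr_ge0 //; last by case: iT.
exact: intertwiner_pos.
Qed.

Lemma intertwinerZ a T : intertwiner T -> intertwiner (a *: T).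
Proof.
move=> [Tb Tc]; split; first exact: bop_scale.
move=> x cx; apply: funext => v /=; rewrite !fctE.
by have := congr1 (@^~ v) (Tc _ cx) => /= ->; rewrite (bopZ (act_bop cx)).
Qed.

(** The weight of aT - S is nonnegative, so the parallelogram law bounds that of aT + S. *)
Lemma sq_integrable_lin a T S : sq_integrable T -> sq_integrable S ->
  sq_integrable (a *: T + S).
Proof.
move=> sT sS; have [[iT _] [iS _]] := (sT, sS); have iaT := intertwinerZ a iT.
split; first exact: intertwiner_lin.
have := weight_parallelogram iaT iS; rewrite weightZ // (sq_weightE sT) (sq_weightE sS) => h.
have p0 : (0 <= phi (adj (a *: T - S)%R \o (a *: T - S)%R))%E.
  exact/(wt_ge0 phiw)/intertwiner_pos/intertwinerB.
by apply: (le_lt_trans (leeDl _ p0)); rewrite h -!EFinM ltry.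
Qed.

Lemma sq_weight_parallelogram T S : sq_integrable T -> sq_integrable S ->
  sq_weight (T + S) + sq_weight (T - S) = 2 * sq_weight T + 2 * sq_weight S.
Proof.
move=> sT sS; have [[iT _] [iS _]] := (sT, sS).
have sD : sq_integrable (T + S) by rewrite -(scale1r T); exact: sq_integrable_lin.
have sB : sq_integrable (T - S) by rewrite -scaleN1r addrC; exact: sq_integrable_lin.
by have := weight_parallelogram iT iS; rewrite !sq_weightE // => -[].
Qed.

Lemma sq_weightZ a T : intertwiner T ->
  sq_weight (a *: T) = complex.Re `|a| ^+ 2 * sq_weight T.
Proof.
move=> iT; rewrite /sq_weight weightZ //.
have := wt_ge0 phiw (intertwiner_pos iT); case: (phi _) => [r _|_|//] //=.
(* Here the weight of T is infinite; [fine] sends infinity to 0, and both sides are 0. *)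
have [->|a0] := eqVneq (complex.Re `|a| ^+ 2) 0; first by rewrite mul0e mul0r.
by rewrite gt0_muley ?mulr0 // lte_fin lt_neqAle eq_sym a0 sqr_ge0.
Qed.

Lemma sq_integrable0 : sq_integrable 0.
Proof.
have i0 : intertwiner (0 : H -> X).
  split; first exact: bop_zero.
  by move=> x cx; apply: funext => v /=; rewrite (bop0 (act_bop cx)).
split=> //; rewrite (_ : _ \o _ = 0) ?weight0 ?ltry //.
by apply: funext => v /=; rewrite (bop0 (bop_adj i0.1)).
Qed.

End SquareIntegrable.
End Weights.

(** * The regular representation *)

Section RegularRepresentation.
Variables (R : realType) (G : lcqg R).
Local Notation H := (L2 G).
Local Notation HH := (L2L2 G).
Local Notation M := (Linf G).
Local Notation phi := (haar G).
Let MN : von_neumann M := Linf_vn G.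
Let phiw : nsf_weight M phi := haar_nsf G.

Let act (x : H -> H) : HH -> HH := tensop HH idfun x.

Let act_bop x : commutant M x -> bop (act x).
Proof. by case=> xb _; apply: bop_tensop => //; exact: bop_id. Qed.

Let act_adj x : commutant M x -> adj (act x) = act (adj x).
Proof. by case=> xb _; rewrite /act adj_tensop ?adj_id //; exact: bop_id. Qed.

Let id_bop x : commutant M x -> bop (id x).
Proof. by case. Qed.

Lemma left_idealE b : left_ideal M phi b <-> sq_integrable M phi id b.
Proof.
by split=> -[h fb]; split=> //; move: h => /(vnP MN).
Qed.

Lemma left_ideal_lin (a : R[i]) b c : left_ideal M phi b -> left_ideal M phi c ->
  left_ideal M phi (a *: b + c).
Proof.
move=> /left_idealE hb /left_idealE hc; apply/left_idealE.
by apply: sq_integrable_lin.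
Qed.

Lemma left_ideal0 : left_ideal M phi 0.
Proof. by apply/left_idealE; apply: sq_integrable0. Qed.

Lemma Lambda_weight b : left_ideal M phi b ->
  phi (adj b \o b) = (rnorm (Lambda G b) ^+ 2)%:E.
Proof.
move=> hb; have := gns_dot (Lambda_gns G) hb; rewrite dotxx => /complexI ->.
have := sq_weightE MN phiw id_bop (fun _ _ => erefl) ((left_idealE b).1 hb).
by move=> ->.
Qed.

Lemma vtens_act X x : vtens HH M M X -> commutant M x -> X \o act x = act x \o X.
Proof.
move=> [_ Xc] cx; apply: Xc; split; first exact: act_bop.
have [xb xc] := cx; have ib := @bop_id R H.
move=> _ [a [b [Ma Mb ->]]]; have [ab bb] := (vn_bop MN Ma, vn_bop MN Mb).
apply: bop_tens_inj; try by apply: bop_comp; [exact: bop_tensop|exact: bop_tensop].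
move=> u v /=; rewrite /act !tensopE //=.
by have := congr1 (@^~ v) (xc _ Mb) => /= ->.
Qed.

Definition delta_tens (f : H) (b : H -> H) : H -> HH := Delta G b \o tens HH f.

Lemma bop_Delta b : M b -> bop (Delta G b).
Proof. by move=> Mb; have [] := sh_map (Delta_hom G) Mb. Qed.

Lemma delta_tens_intertwiner f b : M b -> intertwiner M act (delta_tens f b).
Proof.
move=> Mb; split; first by apply: bop_comp; [exact: bop_Delta|exact: bop_tens].
move=> x cx; have [xb _] := cx; have ib := @bop_id R H.
have := vtens_act (sh_map (Delta_hom G) Mb) cx => h.
rewrite /delta_tens; apply: funext => v /=.
have := congr1 (@^~ (tens HH f v)) h => /= <-.
by rewrite /act tensopE.
Qed.

Lemma delta_tens_slice f b : M b ->
  adj (delta_tens f b) \o delta_tens f b = slice_l f f (Delta G (adj b \o b)).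
Proof.
move=> Mb; have Mb' := vn_adj MN Mb; rewrite /delta_tens.
rewrite (adj_comp (bop_Delta Mb) (@bop_tens _ _ _ HH f)).
by rewrite (sh_mul (Delta_hom G)) // (sh_adj (Delta_hom G)).
Qed.

(** Left invariance for the functional ω_{f,f}, applied to b^* b. *)
Lemma delta_tens_weight f b : left_ideal M phi b ->
  phi (adj (delta_tens f b) \o delta_tens f b) =
  ((rnorm f ^+ 2)%:E * (rnorm (Lambda G b) ^+ 2)%:E)%E.
Proof.
move=> hb; have [Mb fin] := hb; have ib := (left_idealE b).1 hb.
rewrite -Lambda_weight // delta_tens_slice //.
(* Invariance is formulated for sums of vector functionals over all n; ω_{f,f} is the sequence f, 0,
   0, ... *)
pose xi n : H := if n is 0%N then f else 0.
have cst (u : nat -> R[i]^o) : (forall n, u n.+1 = 0) -> series u @ \oo --> u 0%N.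
  move=> u0; apply: cvg_near_cst; near=> n.
  have n0 : (0 < n)%N by near: n; exists 1%N.
  by rewrite /series /= big_ltn // big_nat_cond big1 ?addr0 // => -[|k].
apply: (haar_left (xi := xi)) => //.
- rewrite /functional_mass -dotxx.
  apply: (cst (fun n => ⟨xi n, xi n⟩)) => n; exact: dot0l.
- apply: (intertwiner_pos MN id_bop _ ib.1) => //.
- rewrite -delta_tens_slice //.
  by apply: (intertwiner_mul MN act_bop act_adj); exact: delta_tens_intertwiner.
- move=> eta eta'.
  apply: (cst (fun n => ⟨slice_l (xi n) (xi n) (Delta G (adj b \o b)) eta, eta'⟩)) => n.
  rewrite /slice_l /= adjPl; last exact: bop_tens.
  by rewrite (bilin0l (@tens_bilin _ _ _ HH) eta'); exact: dot0r.
Unshelve. all: by end_near. Qed.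

Lemma delta_tens_sq f b : left_ideal M phi b -> sq_integrable M phi act (delta_tens f b).
Proof.
move=> hb; split; first by apply: delta_tens_intertwiner; case: hb.
by rewrite delta_tens_weight // -EFinM ltry.
Qed.

Lemma delta_tens_linl a f g b : M b ->
  delta_tens (a *: f + g) b = a *: delta_tens f b + delta_tens g b.
Proof.
move=> Mb; apply: funext => v; rewrite /delta_tens !fctE /=.
by rewrite (tens_bilin HH).1 (bop_linear (bop_Delta Mb)).
Qed.

Lemma delta_tens_linr a f b c : M b -> M c ->
  delta_tens f (a *: b + c) = a *: delta_tens f b + delta_tens f c.
Proof. by move=> Mb Mc; rewrite /delta_tens (sh_lin (Delta_hom G)). Qed.

Definition delta_sum (s : seq (H * (H -> H))) : H -> HH :=
  \sum_(p <- s) delta_tens p.1 p.2.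

Definition lambda_sum (s : seq (H * (H -> H))) : HH :=
  \sum_(p <- s) tens HH p.1 (Lambda G p.2).

Lemma delta_sum_sq s : (forall p, p \in s -> left_ideal M phi p.2) ->
  sq_integrable M phi act (delta_sum s).
Proof.
rewrite /delta_sum; elim: s => [|p s IH] hs.
  by rewrite big_nil; apply: sq_integrable0.
rewrite big_cons -[delta_tens _ _]scale1r; apply: sq_integrable_lin => //.
  by apply: delta_tens_sq; apply: hs; rewrite mem_head.
by apply: IH => q qs; apply: hs; rewrite inE qs orbT.
Qed.

(* Left invariance gives the two sides the same value on elementary tensors; as
   both satisfy the parallelogram law, they agree on sums. *)
Lemma delta_sum_weight s : (forall p, p \in s -> left_ideal M phi p.2) ->
  sq_weight phi (delta_sum s) = rnorm (lambda_sum s) ^+ 2.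
Proof.
move=> hs.
pose V : lmodType R[i] := ((H -> HH) * HH)%type.
pose d (v : V) : R := sq_weight phi v.1 - rnorm v.2 ^+ 2.
pose S (f : H) (b : H -> H) : V := (delta_tens f b, tens HH f (Lambda G b)).
have nn (u v : HH) : rnorm (u + v) ^+ 2 + rnorm (u - v) ^+ 2 =
    2 * rnorm u ^+ 2 + 2 * rnorm v ^+ 2 by rewrite Re_dotD Re_dotB; ring.
have : d (\sum_(p <- s) S p.1 p.2) = 0.
  apply: (@parallelogram_vanish R V [set v | sq_integrable M phi act v.1] d _ _ _ _
    H (H -> H) (left_ideal M phi) S left_ideal_lin left_ideal0) => //=.
  - by move=> a [T u] [T' u'] /=; apply: sq_integrable_lin.
  - by apply: sq_integrable0.
  - move=> [T u] [T' u'] /= sT sT'; rewrite /d /=.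
    have := sq_weight_parallelogram MN phiw act_bop act_adj sT sT'.
    by have := nn u u'; lra.
  - move=> [T u] /= [iT _]; rewrite /d /= rnormZ exprMn.
    rewrite (sq_weightZ MN phiw act_bop act_adj) //.
    have -> : `|'i : R[i]| = 1 by rewrite normc_def /= expr0n expr1n add0r sqrtr1.
    by rewrite /= expr1n !mul1r.
  - by move=> f b hb; apply: delta_tens_sq.
  - move=> a f g b [Mb _]; congr pair; first exact: delta_tens_linl.
    exact: (tens_bilin HH).1.
  - move=> a f b c hb hc; congr pair.
      by apply: delta_tens_linr; [case: hb | case: hc].
    by rewrite (gns_lin (Lambda_gns G)) //; exact: (tens_bilin HH).2.
  - move=> f b hb; rewrite /d /= /sq_weight delta_tens_weight // -EFinM /=.
    by rewrite rnorm_tens exprMn subrr.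
have -> : \sum_(p <- s) S p.1 p.2 = (delta_sum s, lambda_sum s).
  rewrite /delta_sum /lambda_sum; elim: s {hs} => [|p s IH]; first by rewrite !big_nil.
  by rewrite !big_cons IH.
by rewrite /d /= => /eqP; rewrite subr_eq0 => /eqP.
Qed.

(** * The vector attached to a square integrable intertwiner *)

Section HilbertSchmidt.
Variable T : H -> HH.
Hypothesis sT : sq_integrable M phi act T.

Let coef (e : H) : H -> H := adj (tens HH e) \o T.

Let Tb : bop T. Proof. by case: sT => -[]. Qed.

Let coef_bop e : bop (coef e).
Proof. by apply: bop_comp => //; apply/bop_adj/bop_tens. Qed.

Let coef_sqE e v : ⟨adj (coef e) (coef e v), v⟩ = (rnorm (adj (tens HH e) (T v)) ^+ 2)%:C.
Proof. by rewrite adjPl // dotxx. Qed.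

Let coef_intertwiner e : intertwiner M id (coef e).
Proof.
split=> // x cx; have [[_ Tc] _] := sT; have [xb _] := cx; have ib := @bop_id R H.
apply: funext => v; apply: dot_inj => y; rewrite /coef /=.
have := congr1 (@^~ v) (Tc _ cx) => /= ->.
rewrite !(adjPl (@bop_tens _ _ _ HH e)) /act (adjP (bop_tensop HH ib xb)).
rewrite adj_tensop // adj_id tensopE //; last exact: bop_adj.
by rewrite (adjP xb) (adjPl (@bop_tens _ _ _ HH e)).
Qed.

(** As t_e t_e^* ≤ |e|^2, the slice a = t_e^* T satisfies a^* a ≤ |e|^2 T^* T. *)
Lemma slice_left_ideal e : left_ideal M phi (adj (tens HH e) \o T).
Proof.
apply/left_idealE; split; first exact: coef_intertwiner.
have [iT _] := sT.
apply: (@le_lt_trans _ _ ((rnorm e ^+ 2)%:E * phi (adj T \o T))%E); last first.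
  by rewrite (sq_weightE MN phiw act_bop act_adj sT) -EFinM ltry.
have pT := intertwiner_pos MN act_bop act_adj iT.
rewrite -(wt_scale phiw) ?sqr_ge0 //; apply: (weight_le MN phiw) => //.
- by apply: (intertwiner_pos MN id_bop _ (coef_intertwiner e)).
- by apply: (posZ MN) => //; exact: sqr_ge0.
- move=> v; rewrite !fctE /= coef_sqE dotZl adjPl // dotxx -rmorphM lecR -exprMn.
  by rewrite lerXn2r ?nnegrE ?mulr_ge0 ?rnorm_ge0 // rnorm_adj_tens.
Qed.

(** Bessel's inequality at every vector T v bounds the sum of the a^* a, over the slices a = t_e^*
    T, by T^* T; then φ is applied, being additive and monotone. *)
Lemma slice_bessel (t : seq (H * H)) : orthonormal_fst t ->
  \sum_(p <- t) rnorm (Lambda G (adj (tens HH p.1) \o T)) ^+ 2 <= sq_weight phi T.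
Proof.
move=> ont; have [iT _] := sT; rewrite -lee_fin -(sq_weightE MN phiw act_bop act_adj sT).
pose z : H -> H := \sum_(p <- t) (adj (coef p.1) \o coef p.1).
have [pz zE] : pos M z /\
    phi z = (\sum_(p <- t) rnorm (Lambda G (adj (tens HH p.1) \o T)) ^+ 2)%:E.
  rewrite /z; elim: t {ont z} => [|p t [pz zE]].
    by rewrite !big_nil (weight0 MN phiw) //; split => //; exact: (pos0 MN).
  have pp := intertwiner_pos MN id_bop (fun _ _ => erefl _) (coef_intertwiner p.1).
  rewrite !big_cons; split; first exact: (posD MN).
  by rewrite (wt_add phiw) // zE EFinD -Lambda_weight //; exact: slice_left_ideal.
rewrite -zE; apply: (weight_le MN phiw) => //; first exact: (intertwiner_pos MN act_bop act_adj iT).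
move=> v; rewrite /= adjPl // dotxx /z fct_sumE dot_suml.
under eq_bigr do rewrite /= coef_sqE.
by rewrite -rmorph_sum lecR bessel.
Qed.

(** [w] plays the role of (ι ⊗ Λ)(T), formally Σ e_i ⊗ Λ(t_{e_i}^* T) over an orthonormal basis. It
    is the Riesz vector of e ⊗ z ↦ ⟨z, Λ(t_e^* T)⟩, which is linear in e because t_e^* is antilinear
    in e and stands in the second slot; the bound is Cauchy-Schwarz and [slice_bessel] after
    orthonormalizing the first legs. *)
Lemma slice_vector : exists2 w : HH,
  forall e z, ⟨w, tens HH e z⟩ = ⟨Lambda G (adj (tens HH e) \o T), z⟩ &
  rnorm w <= Num.sqrt (sq_weight phi T).
Proof.
pose F (e z : H) : R[i]^o := ⟨z, Lambda G (adj (tens HH e) \o T)⟩.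
have Fb : bilin F.
  split=> [a e e' z|a e z z']; last by rewrite /F dotDl dotZl.
  have [[Tb' _] _] := sT.
  rewrite /F [X in Lambda G X](_ : _ = a^*%C *: (adj (tens HH e) \o T) + (adj (tens HH e') \o T)).
    rewrite (gns_lin (Lambda_gns G)); try exact: slice_left_ideal.
    by rewrite dotDr dotZr conjcK.
  apply: funext => v; apply: dot_inj => y; rewrite !fctE /= dotDl dotZl.
  by rewrite !adjPl ?(tens_bilin HH).1 ?dotDr ?dotZr //; exact: bop_tens.
pose rho (v : HH) (r : R[i]) := exists t : seq (H * H),
  v = \sum_(p <- t) tens HH p.1 p.2 /\ r = \sum_(p <- t) F p.1 p.2.
have [||||w wE wn] := @riesz R HH rho (Num.sqrt (sq_weight phi T)).
- by exists [::]; rewrite !big_nil.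
- move=> a _ _ _ _ [s [-> ->]] [s' [-> ->]].
  exists ([seq (a *: p.1, p.2) | p <- s] ++ s'); rewrite !big_cat !big_map /=.
  split; congr (_ + _).
    by rewrite scaler_sumr; apply: eq_bigr => p _; rewrite (bilinZl (tens_bilin HH)).
  by rewrite mulr_sumr; apply: eq_bigr => p _; rewrite (bilinZl Fb).
- move=> _ _ [s [-> ->]]; have [t ont st] := gram_schmidt s.
  rewrite (st _ _ Fb) (st _ _ (tens_bilin HH)) /F.
  rewrite -(dot_orthonormal HH (fun p => Lambda G (adj (tens HH p.1) \o T))) //.
  rewrite (le_trans (dot_le _ _)) // mulrC ler_wpM2r // normE lecR.
  rewrite -(ler_pXn2r (n := 2)) ?nnegrE ?sqrtr_ge0 ?rnorm_ge0 //.
  rewrite sqr_sqrtr; last by case: sT => iT _; apply: (sq_weight_ge0 MN phiw act_bop act_adj).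
  have ont' := orthonormal_map (fun q => Lambda G (adj (tens HH q.1) \o T)) ont.
  have := rnorm_orthonormal (@tens_dot _ _ _ HH) ont'; rewrite !big_map /= => ->.
  exact: slice_bessel.
- exact: sqrtr_ge0.
- exists w => // e z; rewrite dotC -(wE _ (F e z)) -?dotC //.
  by exists [:: (e, z)]; rewrite !big_seq1.
Qed.

End HilbertSchmidt.

Lemma Lambda_total y : (forall b, left_ideal M phi b -> ⟨Lambda G b, y⟩ = 0) -> y = 0.
Proof.
move=> h; apply: (@dense_ortho0 _ _ (Lambda G @` left_ideal M phi)).
  move=> O [x Ox] Oo; have [z [Oz Az]] := gns_dense (Lambda_gns G) (ex_intro _ x Ox) Oo.
  exists z; split=> //; exists 1%N, (fun=> 1), (fun=> z); split=> //.
  by rewrite big_ord1 scale1r.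
by move=> _ [b hb <-]; exact: h.
Qed.

(** [V] sends f ⊗ Λ(b) to the vector that [slice_vector] attaches to Δ(b) t_f. By [delta_sum_weight]
    this is a contraction on finite sums, whence the constant 1; the sums are total because the Λ(b)
    are. *)
Lemma regular_rep_adj_ex : exists2 V : HH -> HH, bop V &
  forall xi xi' b, left_ideal M phi b ->
    slice_l xi xi' V (Lambda G b) = Lambda G (slice_l xi xi' (Delta G b)).
Proof.
pose rho (v w : HH) := exists s : seq (H * (H -> H)),
  [/\ forall p, p \in s -> left_ideal M phi p.2, v = lambda_sum s &
    forall e z, ⟨w, tens HH e z⟩ = ⟨Lambda G (adj (tens HH e) \o delta_sum s), z⟩].
have [||||V Vb VE] := @bop_extension R HH HH rho 1 ler01.
- exists [::]; split => //; first by rewrite /lambda_sum big_nil.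
  move=> e z; rewrite dot0l /delta_sum big_nil.
  rewrite (_ : _ \o _ = 0) => [|]; last first.
    by apply: funext => v /=; rewrite bop0 //; exact/bop_adj/bop_tens.
  have := gns_lin (Lambda_gns G) (-1) left_ideal0 left_ideal0.
  by rewrite !scaleN1r !addNr => ->; rewrite dot0l.
- move=> a _ w _ w' [s [hs -> wE]] [s' [hs' -> wE']].
  have sumE : delta_sum ([seq (a *: p.1, p.2) | p <- s] ++ s') = a *: delta_sum s + delta_sum s'.
    rewrite /delta_sum big_cat big_map scaler_sumr; congr (_ + _).
    rewrite !big_seq; apply: eq_bigr => p /hs [Mb _].
    apply: funext => v; rewrite /delta_tens /= !fctE /=.
    by rewrite (bilinZl (tens_bilin HH)) (bopZ (bop_Delta Mb)).
  exists ([seq (a *: p.1, p.2) | p <- s] ++ s'); split.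
  + by move=> p; rewrite mem_cat => /orP[/mapP[q qs ->]|]; [exact: (hs q) | exact: hs'].
  + rewrite /lambda_sum big_cat big_map scaler_sumr; congr (_ + _).
    by apply: eq_bigr => p _; rewrite (bilinZl (tens_bilin HH)).
  + move=> e z; rewrite dotDl dotZl wE wE' sumE -dotZl -dotDl.
    rewrite -(gns_lin (Lambda_gns G)); try by apply/slice_left_ideal/delta_sum_sq.
    congr (⟨Lambda G _, _⟩); apply: funext => v; rewrite /= !fctE /=.
    by rewrite (bop_linear (bop_adj (@bop_tens _ _ _ HH e))).
- move=> _ w [s [hs -> wE]]; rewrite mul1r.
  have [w' wE' w'n] := slice_vector (delta_sum_sq hs).
  have -> : w = w'.
    apply/eqP; rewrite -subr_eq0; apply/eqP; apply: (@tens_ortho0 _ _ _ HH) => e z.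
    by rewrite dotC dotBl wE wE' subrr conjc0.
  by rewrite (le_trans w'n) // delta_sum_weight // sqrtr_sqr ger0_norm ?rnorm_ge0.
- move=> y h; apply: (@tens_ortho0 _ _ _ HH) => f x.
  have ortho b : left_ideal M phi b -> ⟨tens HH f (Lambda G b), y⟩ = 0.
    move=> hb; have hs p : p \in [:: (f, b)] -> left_ideal M phi p.2.
      by rewrite inE => /eqP ->.
    have [w wE _] := slice_vector (delta_sum_sq hs).
    apply: (h _ w); exists [:: (f, b)]; split => //.
    by rewrite /lambda_sum big_seq1.
  have tb := @bop_tens _ _ _ HH f.
  rewrite adjP // (_ : adj _ y = 0) ?dot0r //.
  by apply: Lambda_total => b hb; rewrite -adjP // ortho.
- exists V => // xi xi' b hb.
  have hs p : p \in [:: (xi, b)] -> left_ideal M phi p.2 by rewrite inE => /eqP ->.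
  have [w wE _] := slice_vector (delta_sum_sq hs).
  rewrite /slice_l /= (VE _ w); last first.
    by exists [:: (xi, b)]; split => //; rewrite /lambda_sum big_seq1.
  apply: dot_inj => z; rewrite adjPl ?wE; last exact: bop_tens.
  by rewrite /delta_sum big_seq1.
Qed.

Lemma regular_rep_spec : bop (@regular_rep R G) /\
  forall xi xi' b, left_ideal M phi b ->
    slice_l xi xi' (adj (@regular_rep R G)) (Lambda G b) =
    Lambda G (slice_l xi xi' (Delta G b)).
Proof.
rewrite /regular_rep; case: xgetP => [W ->//|].
have [V Vb VE] := regular_rep_adj_ex; move=> /(_ (adj V)) [].
by split=> [|xi xi' b hb]; [exact: bop_adj | rewrite adjK // VE].
Qed.

(** If W = 0, then Λ kills every slice of Δ(b); faithfulness makes these slices 0, so Δ(b) = 0, and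
    left invariance forces |h| |Λ(b)| = 0. *)
Lemma regular_rep_neq0 (h : H) : h != 0 -> @regular_rep R G <> fun=> 0.
Proof.
move=> h0 W0; have [_ WE] := regular_rep_spec.
have [b hb b0] : exists2 b, left_ideal M phi b & Lambda G b != 0.
  apply: contrapT => nex; move/eqP: h0; apply; apply: Lambda_total => b hb.
  have [->|b0] := eqVneq (Lambda G b) 0; first by rewrite dot0l.
  by case: nex; exists b.
have [Mb _] := hb; have Db := bop_Delta Mb.
have sl0 xi xi' : slice_l xi xi' (Delta G b) = 0.
  have lb : left_ideal M phi (slice_l xi xi' (Delta G b)).
    by have := slice_left_ideal (delta_tens_sq xi hb) xi'.
  have [Msl _] := lb; have := WE xi xi' b hb; rewrite W0 adj_zero /slice_l /=.
  rewrite bop0; last exact/bop_adj/bop_tens.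
  move=> L0; have := Lambda_weight lb; rewrite /slice_l -L0 rnorm0 expr0n /=.
  have pp := intertwiner_pos MN id_bop (fun _ _ => erefl _) ((left_idealE _).1 lb).1.
  move=> /(wt_faithful phiw pp) sq0; apply: funext => v; apply: rnorm_eq0.
  have := congr1 (fun f => ⟨f v, v⟩) sq0; rewrite /= dot0l adjPl ?dotxx.
    by move=> /complexI/eqP; rewrite sqrf_eq0 => /eqP.
  exact: (vn_bop MN Msl).
have D0 : Delta G b = fun=> 0.
  apply: (@bop_tens_inj _ _ _ HH) => //; first exact: bop_zero.
  move=> x y; apply: (@tens_ortho0 _ _ _ HH) => x' y'.
  have := congr1 (fun f => ⟨y', f y⟩) (sl0 x x').
  by rewrite /slice_l /= dot0r -adjP //; exact: bop_tens.
have := delta_tens_weight h hb.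
rewrite (_ : _ \o _ = 0) ?(weight0 MN phiw); last first.
  apply: funext => v /=; rewrite /delta_tens D0 /= bop0 //.
  by apply: bop_adj; apply: bop_comp; [exact: bop_zero|exact: bop_tens].
move=> []/eqP; rewrite eq_sym mulf_eq0 !sqrf_eq0 => /orP[] /eqP/rnorm_eq0/eqP.
  by rewrite (negPf h0).
by rewrite (negPf b0).
Qed.

(** A nonzero matrix coefficient of W is also one of a slice c of W; rescaling ξ makes it 1. *)
Lemma C0_pairing (h : H) : h != 0 ->
  exists c xi eta, [/\ @C0 R G c, bop c & ⟨c xi, eta⟩ = 1 :> R[i]].
Proof.
move=> h0; have [Wb _] := regular_rep_spec; have W0 := regular_rep_neq0 h0.
have [x [y [x' [y' nz]]]] : exists x y x' y',
    ⟨@regular_rep R G (tens HH x y), tens HH x' y'⟩ != 0 :> R[i].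
  apply: contrapT => nex; apply: W0; apply: (@bop_tens_inj _ _ _ HH) => //.
    exact: bop_zero.
  move=> x y; apply: (@tens_ortho0 _ _ _ HH) => x' y'; rewrite dotC.
  have [->|nz] := eqVneq (⟨@regular_rep R G (tens HH x y), tens HH x' y'⟩ : R[i]) 0.
    exact: conjc0.
  by case: nex; exists x, y, x', y'.
set r := ⟨_, _⟩ in nz.
pose c : H -> H := slice_r y y' (@regular_rep R G).
have tb := @bop_tensr _ _ _ HH.
have cb : bop c.
  by apply: bop_comp => //; apply: bop_comp => //; exact/bop_adj/tb.
exists c, (r^-1 *: x), x'; split => //.
  apply/opclosureP; split => // e e0; exists c => [|v].
    exists 1%N, (fun=> 1), (fun=> c); split=> [_|]; first by exists y, y'.
    by rewrite big_ord1 scale1r.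
  by rewrite !fctE subrr rnorm0 mulr_ge0 ?rnorm_ge0 // ltW.
rewrite (bopZ cb) dotZl /c /slice_r /= adjPl ?dotZl; last exact: tb.
by rewrite -/r mulVf.
Qed.

End RegularRepresentation.

(** * Compact operators and approximate units *)

Section RankOne.
Variables (R : realType) (H : hilbert R).

Lemma normc_le (x y : R) : complex.Re `|x%:C + 'i * y%:C : R[i]| <= `|x| + `|y|.
Proof.
rewrite -lecR (rmorphD (real_complex R)) RRe_real // (le_trans (ler_normD _ _)) //.
rewrite normrM !normc_def /= !expr0n expr1n /= !addr0 add0r !sqrtr_sqr sqrtr1.
by rewrite mul1r.
Qed.

Lemma compact_disc (r : R) (z : H) :
  compact ((fun p : R * R => (p.1 +i* p.2) *: z) @` (`[- r, r] `*` `[- r, r])).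
Proof.
apply: continuous_compact; last by apply: compact_setX; exact: segment_compact.
apply: continuous_subspaceT => q; apply/cvgrPdist_le => e.
rewrite ltcE /= => /andP[/eqP ei e0].
have -> : e = (complex.Re e)%:C by case: e ei {e0} => ? ? /= ->.
set d := complex.Re e in e0 *.
pose K := 2 * rnorm z + 1; have K0 : 0 < K by rewrite ltr_wpDl // mulr_ge0 // rnorm_ge0.
have dK : 0 < d / K by rewrite divr_gt0.
have n1 : \forall p \near q, `|q.1 - p.1| <= d / K.
  have f1 : fst @ nbhs q --> q.1 by exact: cvg_fst.
  by move/cvgrPdist_le : f1 => /(_ _ dK).
have n2 : \forall p \near q, `|q.2 - p.2| <= d / K.
  have f2 : snd @ nbhs q --> q.2 by exact: cvg_snd.
  by move/cvgrPdist_le : f2 => /(_ _ dK).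
near=> p; have h1 : `|q.1 - p.1| <= d / K by near: p.
have h2 : `|q.2 - p.2| <= d / K by near: p.
rewrite -scalerBl normE lecR rnormZ.
set a := q.1 - p.1 in h1; set b := q.2 - p.2 in h2.
have le : complex.Re `|q.1 +i* q.2 - (p.1 +i* p.2)| <= `|a| + `|b|.
  have -> : q.1 +i* q.2 - (p.1 +i* p.2) = a%:C + 'i * b%:C :> R[i].
    apply/eqP; rewrite eq_complex /=.
    by rewrite !(mul0r, mulr0, mul1r, subr0, addr0, add0r, sub0r) !eqxx.
  exact: normc_le.
rewrite (le_trans (ler_wpM2r (rnorm_ge0 z) le)) //.
have -> : d = d / K * K by rewrite divfK // gt_eqF.
by move: (rnorm_ge0 z) (normr_ge0 a); rewrite /K; nra.
Unshelve. all: by end_near. Qed.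

(** By Cauchy-Schwarz the unit ball is sent into the multiples λz with |Re λ|, |Im λ| ≤ |h|, the
    continuous image of a square. *)
Lemma compact_rank_one (h z : H) : compact_op (fun v => ⟨v, h⟩ *: z).
Proof.
have b : bop (fun v : H => ⟨v, h⟩ *: z).
  apply/bopP; split; first by move=> a u v; rewrite dotDl dotZl scalerDl scalerA.
  exists (rnorm h * rnorm z) => [|v]; first by rewrite mulr_ge0 // rnorm_ge0.
  rewrite rnormZ mulrAC ler_wpM2r ?rnorm_ge0 // -lecR RRe_real // rmorphM /= -!normE.
  by rewrite mulrC dot_le.
split=> //.
set Z := (X in compact (closure X)).
have sub : Z `<=` (fun p : R * R => (p.1 +i* p.2) *: z) @`
    (`[- rnorm h, rnorm h] `*` `[- rnorm h, rnorm h]).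
  move=> _ [v /= v1 <-]; exists (complex.Re ⟨v, h⟩, complex.Im ⟨v, h⟩).
    have le : `|⟨v, h⟩| <= (rnorm h)%:C.
      by rewrite (le_trans (dot_le _ _)) // (normE h) ler_piMl // lecR rnorm_ge0.
    have : (complex.Re ⟨v, h⟩) ^+ 2 + (complex.Im ⟨v, h⟩) ^+ 2 <= rnorm h ^+ 2.
      rewrite -lecR add_Re2_Im2 (rmorphXn (real_complex R)).
      by rewrite lerXn2r ?nnegrE ?normr_ge0 // lecR rnorm_ge0.
    move: (rnorm_ge0 h); case: (⟨v, h⟩) => x y /= h0 le2.
    by split; rewrite /= in_itv /=; apply/andP; split; nra.
  by case: (⟨v, h⟩).
have cZ := compact_closed (@norm_hausdorff _ H) (@compact_disc (rnorm h) z).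
apply: (subclosed_compact (@closed_closure _ _) (@compact_disc (rnorm h) z)).
by apply: (subset_trans (closureS sub)); rewrite -((closure_id _).1 cZ).
Qed.

End RankOne.

Section ApproximateUnit.
Variables (R : realType) (K : hilbert R) (D : set (K -> K)).
Hypothesis DC : cstar_algebra D.

Let D_bop x : D x -> bop x. Proof. exact: cs_bop. Qed.

Let DD x y : D x -> D y -> D (x + y).
Proof. by move=> Dx Dy; rewrite -(scale1r x); apply: cs_lin. Qed.

(** A is the sum of the d d^*. *)
Lemma cstar_dominate (ds : seq (K -> K)) : (forall d, d \in ds -> D d) ->
  exists A, [/\ D A, forall x y, ⟨A x, y⟩ = ⟨x, A y⟩,
    forall x, 0 <= complex.Re ⟨A x, x⟩ &
    forall d x, d \in ds -> rnorm (adj d x) ^+ 2 <= complex.Re ⟨A x, x⟩].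
Proof.
elim: ds => [_|d ds IH Dds].
  exists (fun=> 0); split=> [|x y|x|//]; first exact: cs_0.
    by rewrite dot0l dot0r.
  by rewrite dot0l.
have [|A [DA Asa A0 Ad]] := IH; first by move=> e eds; apply: Dds; rewrite inE eds orbT.
have Dd : D d by apply: Dds; rewrite mem_head.
have db := D_bop Dd; have db' := bop_adj db.
have E x : complex.Re ⟨(d \o adj d + A) x, x⟩ = rnorm (adj d x) ^+ 2 + complex.Re ⟨A x, x⟩.
  by rewrite !fctE /= dotDl (adjP db) dotxx raddfD.
exists (d \o adj d + A); split.
- by apply: DD => //; apply: cs_mul => //; exact: cs_adj.
- by move=> x y; rewrite !fctE /= dotDl dotDr Asa adjP // adjPl.
- by move=> x; rewrite E addr_ge0 // sqr_ge0.
- move=> e x; rewrite inE E => /predU1P[->|/Ad le]; first by rewrite lerDl.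
  by rewrite (le_trans (le _)) // lerDr sqr_ge0.
Qed.

Section Contraction.
Variable a : K -> K.
Hypothesis Da : D a.
Hypothesis asa : forall x y, ⟨a x, y⟩ = ⟨x, a y⟩.
Let p x := complex.Re ⟨a x, x⟩.
Hypothesis a_ge0 : forall x, 0 <= p x.
Hypothesis a_le1 : forall x, p x <= rnorm x ^+ 2.

Let ab : bop a. Proof. exact: D_bop. Qed.
Let b x := x - a x.

Let bb : bop b. Proof. by apply: bop_sub => //; exact: bop_id. Qed.

Let pb x : p (b x) = p x - 2 * rnorm (a x) ^+ 2 + p (a x).
Proof.
rewrite /p /b (bopB ab) dotBl !dotBr (asa (a x) x) dotxx !raddfB /=.
ring.
Qed.

(** This is a^2 ≤ a, obtained from ⟨a(bx), bx⟩ ≥ 0 and ⟨a(ax), ax⟩ ≤ |ax|^2. *)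
Let ap x : rnorm (a x) ^+ 2 <= p x.
Proof. by have := pb x; have := a_ge0 (b x); have := a_le1 (a x); lra. Qed.

Let b_step x : rnorm (b x) ^+ 2 <= rnorm x ^+ 2 - p x.
Proof. by rewrite Re_dotB -asa -/(p x); have := ap x; lra. Qed.

Let pb_le x : p (b x) <= p x.
Proof. by rewrite pb; have := a_le1 (a x); have := sqr_ge0 (rnorm (a x)); lra. Qed.

(** The power (1 - a)^n. The approximate unit is 1 - (1 - a)^n, a polynomial in a without constant
    term, hence an element of D even when D has no unit. *)
Definition unit_defect n : K -> K := iter n (fun x => x - a x).

(** Each application of 1 - a lowers the squared norm by at least [p], and [p] decreases along the
    iteration, so the n losses are all at least the last value of [p]. *)
Lemma unit_defect_le n x :
  n%:R * p (unit_defect n x) + rnorm (unit_defect n x) ^+ 2 <= rnorm x ^+ 2.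
Proof.
elim: n => [|n IH]; first by rewrite mul0r add0r.
apply: le_trans IH; rewrite /unit_defect /= -/(unit_defect n x) -/(b _).
have := b_step (unit_defect n x); have := pb_le (unit_defect n x).
have : 0 <= n%:R :> R by rewrite ler0n.
by rewrite mulrSr; nra.
Qed.

Lemma unit_defect_contr n : bounded_by (unit_defect n) 1.
Proof.
move=> x; rewrite mul1r -(ler_pXn2r (n := 2)) ?nnegrE ?rnorm_ge0 //.
apply: le_trans (unit_defect_le n x); rewrite lerDr mulr_ge0 ?ler0n //.
Qed.

Lemma unit_defect_sa n x y : ⟨unit_defect n x, y⟩ = ⟨x, unit_defect n y⟩.
Proof.
rewrite /unit_defect; elim: n x y => // n IH x y.
by rewrite iterS dotBl asa -dotBr IH iterSr.
Qed.

Lemma unit_defect_mem n : D (idfun - unit_defect n).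
Proof.
elim: n => [|n IH].
  by rewrite (_ : _ - _ = fun=> 0); [exact: cs_0|apply: funext => x; rewrite !fctE /= subrr].
rewrite (_ : _ - _ = (idfun - unit_defect n) + (a + (-1) *: (a \o (idfun - unit_defect n)))).
  apply: DD => //; rewrite addrC; apply: cs_lin => //; exact: cs_mul.
apply: funext => x; set y := unit_defect n x.
change (x - (y - a y) = (x - y) + (a x + (-1) *: a (x - y))).
by rewrite scaleN1r (bopB ab) subKr opprB addrA addrAC.
Qed.

End Contraction.

(* With A dominating the d d^* and a = A / C ≤ 1, the vectors z = (1 - a)^n d x
   satisfy |z|^2 ≤ |x| |d^* (1 - a)^n z| and n |d^* (1 - a)^n z|^2 ≤ C |z|^2. *)
Lemma cstar_unit_left (ds : seq (K -> K)) (t : R) : 0 < t ->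
  (forall d, d \in ds -> D d) ->
  exists u, [/\ D u, adj u = u, bounded_by u 2 &
    [/\ bounded_by (idfun - u) 1, bop u &
    forall d x, d \in ds -> rnorm (d x - u (d x)) <= t * rnorm x]].
Proof.
move=> t0 Dds; have [A [DA Asa A0 Ad]] := cstar_dominate Dds.
have [C0 C00 AC0] := bop_bounded (D_bop DA).
(* The added 1 keeps C positive when A = 0. *)
pose C := C0 + 1; have Cp : 0 < C by rewrite ltr_wpDl.
pose a := (C^-1)%:C *: A.
have Da : D a.
  rewrite -[a]addr0; apply: cs_lin => //; exact: cs_0.
have aE x y : ⟨a x, y⟩ = (C^-1)%:C * ⟨A x, y⟩ by rewrite /a fctE dotZl.
have ReE x : complex.Re ⟨a x, x⟩ = C^-1 * complex.Re ⟨A x, x⟩.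
  by rewrite aE; case: (⟨A x, x⟩) => u v /=; rewrite mul0r subr0.
have asa x y : ⟨a x, y⟩ = ⟨x, a y⟩.
  by rewrite aE /a fctE dotZr conjc_real Asa.
have a0 x : 0 <= complex.Re ⟨a x, x⟩ by rewrite ReE mulr_ge0 // invr_ge0 ltW.
have a1 x : complex.Re ⟨a x, x⟩ <= rnorm x ^+ 2.
  rewrite ReE ler_pdivrMl // (le_trans (Re_dot_le _ _)) // expr2 mulrA ler_wpM2r ?rnorm_ge0 //.
  by rewrite (le_trans (AC0 x)) // ler_wpM2r ?rnorm_ge0 // lerDl.
have [n nC] : exists n : nat, C / t ^+ 2 < n%:R.
  have := archi_boundP (ltW (divr_gt0 Cp (exprn_gt0 2 t0))); by exists (Num.bound (C / t ^+ 2)).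
have Dn := unit_defect_mem Da n; have nsa := unit_defect_sa asa n.
have n1 := unit_defect_contr Da asa a0 a1 n.
have ub := D_bop Dn.
pose u : K -> K := idfun - unit_defect a n.
have uE x : u x = x - unit_defect a n x by [].
exists u; split => //.
- by apply: adj_eq => // x y; rewrite !uE dotBl dotBr nsa.
- move=> x; rewrite uE (le_trans (rnormD _ _)) // rnormN.
  by have := n1 x; lra.
split => //; first by rewrite /u opprB addrC subrK.
move=> d x dds; rewrite uE subKr; set z := unit_defect a n (d x).
have db := D_bop (Dds _ dds).
have n0 : 0 < n%:R :> R by apply: lt_trans nC; rewrite divr_gt0 ?exprn_gt0.
have h1 : rnorm (adj d (unit_defect a n z)) ^+ 2 <=
    C * complex.Re ⟨a (unit_defect a n z), unit_defect a n z⟩.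
  by rewrite ReE mulrA divff ?gt_eqF // mul1r; exact: Ad.
have h2 := unit_defect_le Da asa a0 a1 n z.
have h3 : n%:R * rnorm (adj d (unit_defect a n z)) ^+ 2 <= C * rnorm z ^+ 2.
  have := sqr_ge0 (rnorm (unit_defect a n z)).
  move: h1 h2; set P := complex.Re _; set X := _ ^+ 2 => h1 h2 h4.
  have : n%:R * X <= n%:R * (C * P) by rewrite ler_wpM2l // ltW.
  have : C * (n%:R * P) <= C * rnorm z ^+ 2 by rewrite ler_wpM2l ?(ltW Cp) //; lra.
  by move=> ? ?; lra.
have h4 : rnorm z ^+ 2 <= rnorm x * rnorm (adj d (unit_defect a n z)).
  have -> : rnorm z ^+ 2 = complex.Re ⟨x, adj d (unit_defect a n z)⟩.
    by rewrite -adjP // -nsa -/z dotxx.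
  exact: Re_dot_le.
have h5 : C <= t ^+ 2 * n%:R by move: nC; rewrite ltr_pdivrMr ?exprn_gt0 // mulrC => /ltW.
set y := rnorm (adj d _) in h3 h4.
have [z0|z0] := eqVneq (rnorm z) 0; first by rewrite z0 mulr_ge0 ?rnorm_ge0 ?ltW.
have zp : 0 < rnorm z by rewrite lt_neqAle eq_sym z0 rnorm_ge0.
have yt : y <= t * rnorm z.
  rewrite -(ler_pXn2r (n := 2)) ?nnegrE ?mulr_ge0 ?rnorm_ge0 ?(ltW t0) //.
  rewrite -(ler_pM2l n0) exprMn; apply: (le_trans h3).
  by have := ler_wpM2r (sqr_ge0 (rnorm z)) h5; lra.
rewrite -(ler_pM2r zp) -expr2 (le_trans h4) // mulrAC mulrC ler_wpM2r ?rnorm_ge0 //.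
Qed.

Hypothesis Dnd : Defs.nondegenerate D.

Lemma lspan_approx (v : K) : lspan [set v : K | exists d xi, D d /\ v = d xi] v ->
  exists (ds : seq (K -> K)) (L : R), [/\ 0 <= L, forall d, d \in ds -> D d &
    forall (T : K -> K) (t : R), bop T -> 0 <= t ->
    (forall d x, d \in ds -> rnorm (T (d x)) <= t * rnorm x) ->
    rnorm (T v) <= t * L].
Proof.
move: v; apply: lspanP.
  exists [::], 0; split=> // T t Tb t0 _.
  by rewrite (bop0 Tb) rnorm0 mulr0.
move=> c _ v [d [xi [Dd ->]]] [ds [L [L0 Dds dsP]]].
exists (d :: ds), (complex.Re `|c| * rnorm xi + L); split.
- by rewrite addr_ge0 // mulr_ge0 ?rnorm_ge0 // -lecR RRe_real //; exact: normr_ge0.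
- by move=> e; rewrite inE => /predU1P[->//|/Dds].
- move=> T t Tb t0 h; rewrite (bop_linear Tb) (le_trans (rnormD _ _)) //.
  rewrite mulrDr lerD //; last by apply: dsP => // e x eds; apply: h; rewrite inE eds orbT.
  rewrite rnormZ mulrCA ler_wpM2l //; last by apply: h; rewrite mem_head.
  by rewrite -lecR RRe_real //; exact: normr_ge0.
Qed.

(** [ds] and [L] are fixed before [T] and [t], so that [t] can afterwards be chosen small against
    [L] and [T] = 1 - u built from both. *)
Lemma nondegenerate_approx (s : seq K) (e : R) : 0 < e ->
  exists (ds : seq (K -> K)) (L : R), [/\ 0 <= L, forall d, d \in ds -> D d &
    forall (T : K -> K) (t : R), bop T -> 0 <= t -> bounded_by T 1 ->
    (forall d x, d \in ds -> rnorm (T (d x)) <= t * rnorm x) ->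
    forall xi, xi \in s -> rnorm (T xi) <= e + t * L].
Proof.
move=> e0; elim: s => [|x s [ds [L [L0 Dds dsP]]]].
  by exists [::], 0; split.
have [|v sv xv] := @dense_ex _ _ _ x e%:C Dnd; first by rewrite ltcR.
have [ds' [L' [L'0 Dds' dsP']]] := lspan_approx sv.
exists (ds ++ ds'), (L + L'); split; first exact: addr_ge0.
  by move=> d; rewrite mem_cat => /orP[/Dds|/Dds'].
move=> T t Tb t0 T1 h xi; rewrite inE => /predU1P[->|xis].
  rewrite -(subrK v x) (bopD Tb) (le_trans (rnormD _ _)) // lerD //.
    rewrite (le_trans (T1 _)) // mul1r ltW //.
    by move: xv; rewrite normE ltcR.
  rewrite (le_trans (dsP' T t Tb t0 _)) ?ler_wpM2l ?lerDr //.
  by move=> d y dds; apply: h; rewrite mem_cat dds orbT.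
rewrite (le_trans (dsP T t Tb t0 T1 _ xi xis)) ?lerD2l ?ler_wpM2l ?lerDl //.
by move=> d y dds; apply: h; rewrite mem_cat dds.
Qed.

Lemma cstar_unit (s : seq K) (e : R) : 0 < e ->
  exists u, [/\ D u, adj u = u, bounded_by u 2 &
    forall xi, xi \in s -> rnorm (xi - u xi) <= e].
Proof.
move=> e0; have e2 : 0 < e / 2 by rewrite divr_gt0.
have [ds [L [L0 Dds dsP]]] := nondegenerate_approx s e2.
pose t := e / 2 / (L + 1).
have L1 : 0 < L + 1 by rewrite ltr_wpDl.
have t0 : 0 < t by rewrite divr_gt0.
have [u [Du ua u2 [u1 ub dsu]]] := cstar_unit_left t0 Dds.
exists u; split=> // xi xis.
have := dsP (idfun - u) t _ (ltW t0) u1 dsu xi xis.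
move=> /(_ (bop_sub (@bop_id _ _) ub)) /le_trans; apply.
have : e / 2 = t * (L + 1) by rewrite /t divfK // gt_eqF.
by nra.
Qed.

End ApproximateUnit.

(** * Quantum homogeneous spaces *)

Section ClosedSpans.
Variable R : realType.
Implicit Types H K L : hilbert R.

Lemma cspan_sub H K (A : set (H -> K)) x : A x -> bop x -> cspan A x.
Proof.
move=> Ax xb; apply/opclosureP; split=> // e e0; exists x => [|v].
  by exists 1%N, (fun=> 1), (fun=> x); split=> //; rewrite big_ord1 scale1r.
by rewrite !fctE subrr rnorm0 mulr_ge0 ?rnorm_ge0 // ltW.
Qed.

(** The map x ↦ U x V is linear and bounded, and D is a closed subspace; every later passage from
    generators to a closed span goes through this. *)
Lemma cspan_conj H K (D : set (H -> H)) (A : set (K -> K))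
    (U : K -> H) (V : H -> K) :
  cstar_algebra D -> bop U -> bop V -> (forall x, A x -> D (U \o x \o V)) ->
  forall x, cspan A x -> D (U \o x \o V).
Proof.
move=> DC Ub Vb AD x /opclosureP[xb xA]; apply: (cs_closed DC).
apply/opclosureP; split=> [|e e0]; first by do 2 apply: bop_comp => //.
have [cU U0 UcU] := bop_bounded Ub; have [cV V0 VcV] := bop_bounded Vb.
have c0 : 0 < cU * cV + 1 by rewrite ltr_wpDl // mulr_ge0.
have [y Ay xy] := xA (e / (cU * cV + 1)) ltac:(by rewrite divr_gt0).
exists (U \o y \o V).
  move: y Ay {xy}; apply: lspanP.
    rewrite /= (_ : _ \o _ = fun=> 0); first exact: cs_0.
    by apply: funext => v /=; rewrite (bop0 Ub).
  move=> a y z Ay Dz /=.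
  rewrite (_ : _ \o _ = a *: (U \o y \o V) + (U \o z \o V)).
    by apply: cs_lin => //; exact: AD.
  by apply: funext => v; rewrite /= !fctE (bop_linear Ub).
move=> v; rewrite !fctE /= -(bopB Ub) (le_trans (UcU _)) //.
have := xy (V v); rewrite !fctE => h1; have h2 := VcV v.
have eE : e = e / (cU * cV + 1) * (cU * cV + 1) by rewrite divfK // gt_eqF.
have d0 : 0 <= e / (cU * cV + 1) by rewrite ltW // divr_gt0.
rewrite eE; move: (e / _) d0 h1 => d d0 h1.
have h3 : d * rnorm (V v) <= d * (cV * rnorm v) by rewrite ler_wpM2l.
have h4 : cU * rnorm (x (V v) - y (V v)) <= cU * (d * (cV * rnorm v)).
  by rewrite ler_wpM2l // (le_trans h1).
have := rnorm_ge0 v; move: h4 d0; nra.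
Qed.

Lemma ctens_slice H K (T : htensor H K) (A : set (H -> H)) (B : set (K -> K))
    (X : T -> T) xi eta : cstar_algebra B -> (forall a, A a -> bop a) ->
  ctens T A B X -> B (adj (tens T eta) \o X \o tens T xi).
Proof.
move=> BC Ab; apply: cspan_conj => //; first exact/bop_adj/bop_tens.
  exact: bop_tens.
move=> _ [a [b [/Ab ab Bb ->]]]; have bb := cs_bop BC Bb.
rewrite (_ : _ \o _ = ⟨a xi, eta⟩ *: b + (fun=> 0)).
  by apply: cs_lin => //; exact: cs_0.
by apply: funext => v; rewrite !fctE /= tensopE // adj_tens addr0.
Qed.

End ClosedSpans.

Section QuantumHomogeneousSpaces.
Variables (R : realType) (G : lcqg R) (K : hilbert R).
Variables (GK : htensor (L2 G) K) (GGK : htensor (L2 G) GK).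
Variables (N : set (K -> K)) (DN : (K -> K) -> (GK -> GK)).
Hypothesis NN : von_neumann N.
Hypothesis DN1 : DN idfun = idfun.
Hypothesis DN_bop : forall x, N x -> bop (DN x).

Let C0_bop (c : L2 G -> L2 G) : C0 c -> bop c. Proof. by case. Qed.

Let tb xi : bop (tens GK xi). Proof. exact: bop_tens. Qed.

Section Slices.
Variables (D : gcstar GGK).
Hypothesis hD : qhs_conditions N DN D.

Let DC := gc_cstar D.

(** Δ(x) multiplies K(L^2(G)) ⊗ D; applied to k ⊗ d with k of rank one and kh = ξ, and compressed by
    t_η^* and t_h, it yields the operator in question. *)
Lemma coaction_slice_mul (h xi eta : L2 G) x d : h != 0 -> N x -> C0D D d ->
  C0D D ((adj (tens GK eta) \o DN x \o tens GK xi) \o d).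
Proof.
move=> h0 Nx Dd; have db := cs_bop DC Dd.
pose k v := ⟨v, (`|h| ^- 2) *: h⟩ *: xi.
have kh : k h = xi.
  rewrite /k dotZr hdot_norm (_ : _^*%C = `|h| ^- 2).
    by rewrite mulVf ?scale1r // expf_eq0 normr_eq0.
  by rewrite normE -(rmorphXn (real_complex R)) -(fmorphV (real_complex R)) conjc_real.
have kc : compact_op k by exact: compact_rank_one.
have [kb _] := kc.
have kd : ctens GK (@compact_op _ (L2 G)) (C0D D) (tensop GK k d).
  by apply: cspan_sub; [exists k, d | exact: bop_tensop].
have [_ /(_ _ kd) [Xkd _]] := qc_mult hD Nx.
have := @ctens_slice _ _ _ GK _ _ _ h eta DC (fun a (ca : compact_op a) => ca.1) Xkd.
rewrite (_ : _ \o _ = (adj (tens GK eta) \o DN x \o tens GK xi) \o d) //.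
by apply: funext => v /=; rewrite tensopE // kh.
Qed.

(** Here no factor of D stands on the right; instead x is taken in D and the vector in the range of
    some c in [C0], so that Δ(d)(c ⊗ 1) lies in C_0(G) ⊗ D. *)
Lemma coaction_slice_mem (c : L2 G -> L2 G) xi eta d : C0 c -> C0D D d ->
  C0D D (adj (tens GK eta) \o DN d \o tens GK (c xi)).
Proof.
move=> cc Dd; have cb := C0_bop cc.
have X : ctens GK (@C0 _ G) (C0D D) (DeltaD D d \o tensop GK c idfun).
  rewrite -(gc_continuous D); apply: cspan_sub; first by exists d, c.
  rewrite (qc_restr hD Dd); apply: bop_comp; first exact/DN_bop/(qc_sub hD).
  by apply: bop_tensop => //; exact: bop_id.
have := @ctens_slice _ _ _ GK _ _ _ xi eta DC C0_bop X.
rewrite (qc_restr hD Dd) (_ : _ \o _ = adj (tens GK eta) \o DN d \o tens GK (c xi)) //.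
by apply: funext => v /=; rewrite tensopE //; exact: bop_id.
Qed.

(* An approximate unit converges *-strongly to 1, which strictness turns into
   norm convergence on the Hilbert module. *)
Lemma strict_unit (A : set (K -> K)) (v : K -> GK) (e : R) :
  cstar_algebra A -> Defs.nondegenerate A -> A `<=` N -> hmodule (C0D D) v -> 0 < e ->
  exists2 u, A u & bounded_by ((DN u \o v) - v) e.
Proof.
move=> AC And AN vD e0.
(* The index set consists of the candidate units themselves. Self-adjointness makes strong
   convergence *-strong, and the bound 2 is the uniform bound that strictness asks for. *)
pose I := {u : K -> K | [/\ A u, adj u = u & bounded_by u 2]}.
pose x (i : I) := projT1 i.
pose B (p : seq K * R) : set I := [set i | forall xi, xi \in p.1 -> rnorm (xi - x i xi) <= p.2].
pose F : set_system I := filter_from [set p | 0 < p.2] B.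
have FF : ProperFilter F.
  apply: filter_from_proper.
    apply: filter_from_filter; first by exists ([::], 1) => /=.
    move=> [s d] [s' d'] /= d0 d'0; exists (s ++ s', Num.min d d') => /=.
      by rewrite lt_min d0.
    move=> i h; split=> xi xis; have := h xi; rewrite /= mem_cat xis ?orbT => /(_ isT);
      by rewrite le_min => /andP[].
  move=> [s d] /= d0; have [u [Au ua u2 us]] := cstar_unit AC And s d0.
  by exists (exist _ u (And3 Au ua u2)).
have xcvg xi : x i xi @[i --> F] --> idfun xi.
  apply/cvgrPdist_le => d; rewrite ltcE /= => /andP[/eqP di d0].
  exists ([:: xi], complex.Re d) => // i /(_ xi); rewrite inE eqxx => /(_ isT) le.
  by rewrite /= (_ : d = (complex.Re d)%:C) ?normE ?lecR //; case: d di {d0 le} => ? ? /= ->.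
have xA i : A (x i) by rewrite /x; case: i => u [].
have xa i : adj (x i) = x i by rewrite /x; case: i => u [].
have x2 i : bounded_by (x i) 2 by rewrite /x; case: i => u [].
have [] := @qc_strict _ _ _ _ _ _ _ _ hD I F x idfun 2%:C FF _ _ _ _ _ v vD e%:C.
- by move=> i; exact: AN.
- exact: vn_id.
- by move=> i; apply/opnorm_leE.
- exact: xcvg.
- by move=> xi; rewrite adj_id; under eq_cvg do rewrite xa; exact: xcvg.
- by rewrite ltcR.
- move=> nF _; have [i /opnorm_leE] := @filter_ex _ _ FF _ nF.
  by rewrite DN1; exists (x i).
Qed.

End Slices.

Section TwoAlgebras.
Variables (D1 D2 : gcstar GGK).
Hypotheses (h1 : qhs_conditions N DN D1) (h2 : qhs_conditions N DN D2).

Lemma C0D_mul (h : L2 G) d1 d2 : h != 0 -> C0D D1 d1 -> C0D D2 d2 -> C0D D2 (d1 \o d2).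
Proof.
move=> h0 Dd1 Dd2; have [c [xi [eta [cc cb ceta]]]] := C0_pairing h0.
have [d1b d2b] := (cs_bop (gc_cstar D1) Dd1, cs_bop (gc_cstar D2) Dd2).
have X : ctens GK (@C0 _ G) (C0D D1) (tensop GK c d1).
  by apply: cspan_sub; [exists c, d1 | exact: bop_tensop].
rewrite -(gc_continuous D1) in X.
have Vb : bop (tens GK xi \o d2) by exact: bop_comp.
have := cspan_conj (gc_cstar D2) (bop_adj (tb eta)) Vb _ X.
rewrite (_ : _ \o _ = d1 \o d2).
  (* On a generator Δ(d)(c' ⊗ 1) the compression equals t_η^* Δ(d) t_{c'ξ} d2, in which d enters
     only as an element of N. *)
  apply=> _ [d [c' [Dd cc' ->]]]; have cb' := C0_bop cc'.
  rewrite (qc_restr h1 Dd).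
  have := coaction_slice_mul h2 (c' xi) eta h0 (qc_sub h1 Dd) Dd2.
  rewrite (_ : _ \o _ = adj (tens GK eta) \o (DN d \o tensop GK c' idfun) \o (tens GK xi \o d2)) //.
  by apply: funext => v /=; rewrite tensopE //; exact: bop_id.
by apply: funext => v /=; rewrite tensopE // adj_tens ceta scale1r.
Qed.

End TwoAlgebras.

Lemma C0D_sub (D1 D2 : gcstar GGK) (h : L2 G) :
  qhs_conditions N DN D1 -> qhs_conditions N DN D2 -> h != 0 ->
  C0D D1 `<=` C0D D2.
Proof.
move=> h1 h2 h0 d Dd; have [c [xi [eta [cc cb ceta]]]] := C0_pairing h0.
have [DC1 DC2] := (gc_cstar D1, gc_cstar D2); have db := cs_bop DC1 Dd.
apply: (cs_closed DC2); apply/opclosureP; split => // e e0.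
have n0 : 0 < rnorm eta + 1 by rewrite ltr_wpDl ?rnorm_ge0.
have vb : bop (tens GK (c xi) \o d) by exact: bop_comp.
have vD : hmodule (C0D D1) (tens GK (c xi) \o d).
  by apply: cspan_sub => //; exists (c xi), d.
(* The unit comes from D2, while the module and the strictness are those of D1. Compression by t_η^*
   costs a factor |η|, whence the tolerance e / (|η| + 1). *)
have [u Du uv] := strict_unit h1 DC2 (gc_nondeg D2) (@qc_sub _ _ _ _ _ _ _ _ h2) vD
  (divr_gt0 e0 n0).
set y := adj (tens GK eta) \o DN u \o tens GK (c xi).
have Dy : C0D D2 y by exact: coaction_slice_mem.
have yb := cs_bop DC2 Dy.
exists (y \o d).
  (* [C0D_mul] puts a product in D2 when the factor from D1 is on the left, so y d is treated
     through its adjoint d^* y^*. *)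
  rewrite -(adjK (bop_comp yb db)) adj_comp //; apply: cs_adj => //.
  by apply: (C0D_mul h1 h2 h0); apply: cs_adj.
move=> w; have -> : (d - (y \o d)) w = - adj (tens GK eta)
    (DN u (tens GK (c xi) (d w)) - tens GK (c xi) (d w)).
  by rewrite (bopB (bop_adj (tb eta))) adj_tens ceta scale1r opprB.
rewrite rnormN (le_trans (rnorm_adj_tens _ _)) //.
have le1 := ler_wpM2l (rnorm_ge0 eta) (uv w).
have d0 : 0 < e / (rnorm eta + 1) by rewrite divr_gt0.
have w0 := mulr_ge0 (ltW d0) (rnorm_ge0 w); rewrite (le_trans le1) //.
have -> : e * rnorm w = e / (rnorm eta + 1) * rnorm w * (rnorm eta + 1).
  by rewrite mulrAC divfK // gt_eqF.
by rewrite mulrC ler_wpM2l // lerDl.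
Qed.

End QuantumHomogeneousSpaces.

Theorem proposition3p4 (R : realType) (G : lcqg R) (K : hilbert R)
    (GK : htensor (L2 G) K) (GGK : htensor (L2 G) GK)
    (N : set (K -> K)) (DN : (K -> K) -> (GK -> GK)) (hN : qhs GGK N DN)
    (D1 D2 : gcstar GGK)
    (h1 : qhs_conditions N DN D1) (h2 : qhs_conditions N DN D2) :
  C0D D1 = C0D D2 /\
  forall x, C0D D1 x -> DeltaD D1 x = DeltaD D2 x.
Proof.
have [NN coN _ _] := hN.
suff eD : C0D D1 = C0D D2.
  by split=> // x Dx; rewrite (qc_restr h1) // (qc_restr h2) // -eD.
have DN_bop x : N x -> bop (DN x) by move=> /(sh_map (co_hom coN)) [].
have [[h h0]|L2_0] := pselect (exists h : L2 G, h != 0).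
  apply/seteqP; split.
    exact: (C0D_sub NN (co_unital coN) DN_bop h1 h2 h0).
  exact: (C0D_sub NN (co_unital coN) DN_bop h2 h1 h0).
(* If L^2(G) = 0 then L^2(G) ⊗ K = 0, and the injectivity of the coactions leaves
   no room for a nonzero algebra. *)
have GK0 (f g : GK -> GK) : f = g.
  have v0 (v : GK) : v = 0.
    apply: (@tens_ortho0 _ _ _ GK) => x y; have [->|x0] := eqVneq x 0.
      by rewrite (bilin0l (tens_bilin GK)) dot0l.
    by case: L2_0; exists x.
  by apply: funext => v; rewrite (v0 (f v)) (v0 (g v)).
have triv (D : gcstar GGK) : C0D D = [set fun=> 0].
  have D0 := cs_0 (gc_cstar D).
  apply/seteqP; split=> [d Dd|_ -> //].
  by apply: (gc_inj (g := D)); rewrite ?inE.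
by rewrite !triv.
Qed.
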